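(* Let $r\ge0$ be an integer and let $J\subseteq\mathbb{N}_0$ be either $J=\{0,\dots,N-1\}$ for some $N\in\mathbb{N}$ or $J=\mathbb{N}_0$. Let $\mathcal{X}$ be the determinantal point process on $\mathbb{C}$ with correlation kernel $$K_{r,J}(z,z')=e^{-\frac{\pi}{2}(|z|^2+|z'|^2)}\sum_{j\in J}H_{j,r}(z,\overline z)\,\overline{H_{j,r}(z',\overline{z'})}.$$ Then the family $\{D_R:R>0\}$ of all disks in $\mathbb{C}$ centered at the origin is simultaneously observable for $\mathcal{X}$.
   Context: Laguerre polynomials: $L_j^{\alpha}(x)=\sum_{i=0}^{j}(-1)^i\binom{j+\alpha}{j-i}\frac{x^i}{i!}$. Complex Hermite polynomials: $H_{j,r}(z,\overline z)=\sqrt{\frac{r!}{j!}}\pi^{\frac{j-r}{2}}z^{j-r}L_r^{j-r}(\pi|z|^2)$ if $j>r$, and $H_{j,r}(z,\overline z)=(-1)^{r-j}\sqrt{\frac{j!}{r!}}\pi^{\frac{r-j}{2}}\overline{z}^{\,r-j}L_j^{r-j}(\pi|z|^2)$ if $j\le r$. For a determinantal point process with Hermitian locally trace-class kernel $K$ (whose integral operator $P_K$ is an orthogonal projection here), and a measurable set $\Omega$, the restriction operator is $T_\Omega F=1_\Omega\,P_K(1_\Omega F)$ on $L^2(\mathbb{C})$. A family of sets $\{\Omega_\gamma:\gamma\in\Gamma\}$ is simultaneously observable for the process if, with $\Omega=\bigcup_\gamma\Omega_\gamma$, there is an orthogonal basis $\{\varphi_j:j\in J'\}$ of the closure of the range of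 $T_\Omega$ consisting of eigenfunctions of $T_\Omega$ such that for each $\gamma\in\Gamma$ the restricted functions $\{\varphi_j|_{\Omega_\gamma}:j\in J'\}$ are mutually orthogonal in $L^2(\Omega_\gamma)$. *)

(* Defs.v *)
(* MathComp + MathComp-Analysis (Lebesgue measure/integral on R x R),
   complex numbers R[i] from mathcomp-real-closed. *)
From HB Require Import structures.
From mathcomp Require Import all_boot all_order all_algebra.
From mathcomp Require Import all_classical all_reals all_analysis.
From mathcomp Require Import complex.
Set Implicit Arguments. Unset Strict Implicit. Unset Printing Implicit Defensive.
Import Order.TTheory GRing.Theory Num.Theory.
Import numFieldNormedType.Exports.
Local Open Scope classical_set_scope.
Local Open Scope ring_scope.
Local Open Scope complex_scope.

Section Defs.
Variable R : realType.
Local Notation C := R[i].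

(** The complex plane, as R x R with (product) Lebesgue measure. *)
Definition plane := (measurableTypeR R * measurableTypeR R)%type.
Definition leb2 := (@lebesgue_measure R \x @lebesgue_measure R)%E.

(** the point p = (x,y) of the plane is the complex number x + i y *)
Definition toC (p : plane) : C := p.1 +i* p.2.

(** |z| *)
Definition cmod (z : C) : R := Num.sqrt (complex.Re z ^+ 2 + complex.Im z ^+ 2).

(** Laguerre polynomial L_j^alpha(x) (alpha a natural number here) *)
Definition laguerre (j alpha : nat) (x : R) : R :=
  \sum_(i < j.+1) (-1) ^+ i * ('C(j + alpha, j - i))%:R * x ^+ i / (i`!)%:R.

(** complex Hermite polynomial H_{j,r}(z, zbar) *)
Definition hermiteC (j r : nat) (z : C) : C :=
  if (r < j)%N then
    (Num.sqrt ((r`!)%:R / (j`!)%:R) * Num.sqrt pi ^+ (j - r)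
      * laguerre r (j - r) (pi * cmod z ^+ 2))%:C * z ^+ (j - r)
  else
    ((-1) ^+ (r - j) * Num.sqrt ((j`!)%:R / (r`!)%:R) * Num.sqrt pi ^+ (r - j)
      * laguerre j (r - j) (pi * cmod z ^+ 2))%:C * (z^*)%C ^+ (r - j).

(** j-th summand of the kernel K_{r,J} *)
Definition kterm (r j : nat) (z w : C) : C :=
  (expR (- (pi / 2) * (cmod z ^+ 2 + cmod w ^+ 2)))%:C
    * hermiteC j r z * (hermiteC j r w)^*%C.

(** K_{r,J}(z,w) = sum_{j in J} kterm r j z w, defined as the limit of the
    partial sums over j < n, j in J (real and imaginary parts separately);
    for finite J the partial sums are eventually constant. *)
Definition kpart (J : set nat) (r n : nat) (z w : C) : C :=
  \sum_(j < n | (j : nat) \in J) kterm r j z w.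

Definition kernelK (J : set nat) (r : nat) (z w : C) : C :=
  limn (fun n => complex.Re (kpart J r n z w)) +i* limn (fun n => complex.Im (kpart J r n z w)).

(** complex-valued Lebesgue integral over A *)
Definition cint (A : set plane) (f : plane -> C) : C :=
  Rintegral leb2 A (fun p => complex.Re (f p)) +i* Rintegral leb2 A (fun p => complex.Im (f p)).

(** f is (a representative of an element of) L^2(C) *)
Definition L2 (f : plane -> C) : Prop :=
  [/\ measurable_fun setT (fun p => complex.Re (f p)),
      measurable_fun setT (fun p => complex.Im (f p)) &
      (\int[leb2]_p ((cmod (f p)) ^+ 2)%:E < +oo)%E].

(** inner product of L^2(A) *)
Definition inner (A : set plane) (f g : plane -> C) : C :=
  cint A (fun p => f p * (g p)^*%C).

(** squared norm of L^2(C) *)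
Definition norm2 (f : plane -> C) : R :=
  Rintegral leb2 setT (fun p => cmod (f p) ^+ 2).

(** indicator function (complex-valued) *)
Definition cind (A : set plane) (p : plane) : C := (\1_A p : R)%:C.

(** integral operator P_K *)
Definition intop (K : C -> C -> C) (F : plane -> C) : plane -> C :=
  fun p => cint setT (fun q => K (toC p) (toC q) * F q).

(** restriction operator T_Omega F = 1_Omega P_K (1_Omega F) *)
Definition restrop (K : C -> C -> C) (Om : set plane) (F : plane -> C)
  : plane -> C :=
  fun p => cind Om p * intop K (fun q => cind Om q * F q) p.

(** g lies in the closure (in L^2) of the range of T (on L^2) *)
Definition in_closure_range (T : (plane -> C) -> plane -> C) (g : plane -> C)
  : Prop :=
  L2 g /\ forall e : R, 0 < e ->
    exists F, L2 F /\ norm2 (fun p => T F p - g p) < e.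

(** simultaneous observability of the family {Om i : i in Gamma} for the
    determinantal point process with kernel K *)
Definition simultaneously_observable (K : C -> C -> C) (I : Type)
  (Gamma : set I) (Om : I -> set plane) : Prop :=
  let Omega := \bigcup_(i in Gamma) Om i in
  let T := restrop K Omega in
  exists (J' : Type) (phi : J' -> plane -> C),
    (* each phi j is a nonzero element of the closure of the range,
       and an eigenfunction of T *)
    (forall j, [/\ L2 (phi j), in_closure_range T (phi j),
       0 < norm2 (phi j) &
       exists lam : C, norm2 (fun p => T (phi j) p - lam * phi j p) = 0])
    (* mutual orthogonality in L^2(C) *)
    /\ (forall j k, j <> k -> inner setT (phi j) (phi k) = 0)
    (* the closed linear span of the phi j is the closure of the range *)
    /\ (forall g, in_closure_range T g -> forall e : R, 0 < e ->
          exists s : seq (J' * C),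
            norm2 (fun p => g p - \sum_(x <- s) x.2 * phi x.1 p) < e)
    (* restrictions mutually orthogonal in each L^2(Om i) *)
    /\ (forall i, Gamma i -> forall j k, j <> k ->
          inner (Om i) (phi j) (phi k) = 0).

(** open disk of radius Rr centered at the origin *)
Definition disk (Rr : R) : set plane := [set p | cmod (toC p) < Rr].

End Defs.

(* Main.v *)
Require Import Defs.
From HB Require Import structures.
From mathcomp Require Import all_boot all_order all_algebra.
From mathcomp Require Import all_classical all_reals all_analysis.
From mathcomp Require Import complex.
From mathcomp Require Import measurable_realfun ring lra zify.
Import Order.TTheory GRing.Theory Num.Theory.
Import numFieldNormedType.Exports.
Set Implicit Arguments.
Unset Strict Implicit.
Unset Printing Implicit Defensive.
Local Open Scope classical_set_scope.
Local Open Scope ring_scope.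
Local Open Scope complex_scope.

(** With [Omega = C] the restriction operator is the integral operator of the
    kernel [K p q = \sum_(j in J) phi_j p * conj (phi_j q)], where
    [phi_j z = exp (- pi |z|^2 / 2) * H_{j,r} z].  The eigenbasis is
    [(phi_j)_(j in J)] itself, all eigenvalues being 1.

    Orthogonality on rotation-invariant sets comes from
    [phi_j (u z) = u^j (conj u)^r phi_j z] for [|u| = 1] and the invariance of
    Lebesgue measure under rotations, which are products of three shears.

    The norms are computed from [\int |z|^(2m) exp (- s |z|^2) dz = pi m! / s^(m+1)]
    (differentiation in [s]) and an alternating Vandermonde identity.  Since
    moreover [\sum_j |phi_j z|^2] is finite for every [z], Fatou's lemma turns the
    pointwise convergence of the series for [K p _], and then of
    [\sum_j <F, phi_j> phi_j = T F], into convergence in L^2. *)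

(** * The Gram sum of Laguerre coefficients *)

Section AlternatingVandermonde.
Variable R : comNzRingType.

(** The coefficient of x^m in (1 + x)^N / (1 + x)^(b + 1), that is, in (1 + x)^(N - b - 1). Raising
    [N] multiplies the series by 1 + x and raising [b] divides it by 1 + x; the recurrences below
    express this. *)
Definition altvdm (N b m : nat) : R :=
  \sum_(i < m.+1) (-1) ^+ i * ('C(N, m - i) * 'C(b + i, i))%:R.

Lemma altvdmSl N b m : altvdm N.+1 b m.+1 = altvdm N b m.+1 + altvdm N b m.
Proof.
rewrite /altvdm big_ord_recr [in RHS]big_ord_recr /= !subnn !bin0.
rewrite addrAC -big_split /=; congr (_ + _); apply: eq_bigr => i _.
have im : (i <= m)%N by rewrite -ltnS.
by rewrite subSn // binS mulnDl natrD mulrDr.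
Qed.

Lemma altvdmSr N b m : altvdm N b.+1 m.+1 = altvdm N b m.+1 - altvdm N b.+1 m.
Proof.
rewrite /altvdm big_ord_recl [in RHS]big_ord_recl /= !bin0 -addrA; congr (_ + _).
rewrite -sumrB; apply: eq_bigr => i _; rewrite /bump /= add1n subSS addSn addnS.
by rewrite binS mulnDr natrD !exprS mulrDr !mulN1r !mulNr.
Qed.

Lemma altvdm0 N b : altvdm N b 0 = 1.
Proof. by rewrite /altvdm big_ord1 /= !bin0 expr0 mul1r. Qed.

Lemma altvdmSS N b m : altvdm N.+1 b.+1 m = altvdm N b m.
Proof.
case: m => [|m]; first by rewrite !altvdm0.
by rewrite altvdmSl altvdmSr subrK.
Qed.

(** Simultaneous shifts of both indices cancel, which leaves [n = 0], where only the term [i = m]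
    survives. *)
Lemma altvdm_eq n m : altvdm n n m = (-1) ^+ m.
Proof.
elim: n => [|n IH]; last by rewrite altvdmSS.
rewrite /altvdm big_ord_recr /= subnn bin0 add0n binn mulr1 big1 ?add0r // => i _.
by rewrite bin0n subn_eq0 leqNgt ltn_ord mulr0.
Qed.

(** Here the series is the polynomial (1 + x)^n. Shifts reduce to [b = 0]; induction on [n] is then
    Pascal's rule, starting from the constant 1, whose higher coefficients vanish because
    consecutive signs in [altvdm_eq] cancel. *)
Lemma altvdm_lt n b m : altvdm (n + b).+1 b m = 'C(n, m)%:R.
Proof.
elim: b => [|b IH]; last by rewrite addnS altvdmSS.
rewrite addn0; case: m => [|m]; first by rewrite altvdm0 bin0.
elim: n m => [|n IH] m.
  by rewrite altvdmSl !altvdm_eq exprS mulN1r addNr.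
case: m => [|m].
  by rewrite altvdmSl IH altvdm0 !bin1 -natr1.
by rewrite altvdmSl !IH binS natrD.
Qed.

End AlternatingVandermonde.

(* The Gamma-weighted square of the Laguerre polynomial: the monomial
   [x ^ (alpha + i + k)] is integrated to [(alpha + i + k)!]. *)
Lemma laguerre_gram (R : numFieldType) (m a : nat) :
  \sum_(i < m.+1) \sum_(k < m.+1)
    ((-1) ^+ i * 'C(m + a, m - i)%:R / i`!%:R) *
    ((-1) ^+ k * 'C(m + a, m - k)%:R / k`!%:R) * ((a + i + k)`!)%:R
  = (m + a)`!%:R / m`!%:R :> R.
Proof.
have natf n : n`!%:R != 0 :> R by rewrite pnatr_eq0 -lt0n fact_gt0.
rewrite exchange_big /=.
have inner_sum (k : nat) : \sum_(i < m.+1)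
    ((-1) ^+ i * 'C(m + a, m - i)%:R / i`!%:R) *
    ((-1) ^+ k * 'C(m + a, m - k)%:R / k`!%:R) * ((a + i + k)`!)%:R
  = ((-1) ^+ k * 'C(m + a, m - k)%:R / k`!%:R) * (a + k)`!%:R
    * altvdm R (m + a) (a + k) m.
  rewrite /altvdm big_distrr /=; apply: eq_bigr => i _.
  have e : ((a + i + k)`!)%:R = ('C(a + k + i, i) * (i`! * (a + k)`!))%:R :> R.
    by have := bin_fact (leq_addl (a + k) i); rewrite addnK => ->; rewrite addnAC.
  by rewrite e !natrM; field; rewrite !natf.
under eq_bigr do rewrite inner_sum.
(* Only [k = m] contributes: for [k < m] the inner sum is the binomial coefficient of [m - k.+1]
   over [m], which is 0. This is the orthogonality of a Laguerre polynomial to lower powers. *)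
rewrite big_ord_recr /= big1 => [|k _].
  rewrite add0r [(m + a)%N]addnC altvdm_eq subnn bin0 mulr1.
  rewrite mulrC !mulrA -exprMn mulrNN mulr1 expr1n mul1r mulrC //.
have km : (k < m)%N := ltn_ord k.
have -> : (m + a = ((m - k.+1) + (a + k)).+1)%N by lia.
have sm : (m - k.+1 < m)%N by lia.
by rewrite altvdm_lt (bin_small sm) mulr0.
Qed.

(** * Gaussian moments in the plane *)

Section GaussianMoments.
Variable R : realType.
Local Notation plane := (plane R).
Local Notation leb2 := (@leb2 R).

Definition sqn (p : plane) : R := p.1 ^+ 2 + p.2 ^+ 2.

Lemma sqn_ge0 p : 0 <= sqn p. Proof. by rewrite addr_ge0 ?sqr_ge0. Qed.

Lemma measurable_sqn : measurable_fun setT sqn.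
Proof.
apply: measurable_funD; apply: measurable_funX; first exact: measurable_fst.
exact: measurable_snd.
Qed.

Lemma integral_gauss1 (s : R) : 0 < s ->
  (\int[lebesgue_measure]_x (expR (- s * x ^+ 2))%:E = (Num.sqrt (pi / s))%:E)%E.
Proof.
(* [t] is the standard deviation of the centred normal density proportional to exp(- s x^2). *)
move=> s0; pose t := Num.sqrt (2 * s)^-1.
have t2 : t ^+ 2 = (2 * s)^-1 by rewrite sqr_sqrtr // invr_ge0; lra.
have t0 : t != 0 by rewrite gt_eqF // sqrtr_gt0 invr_gt0; lra.
have peakE : normal_peak t = (Num.sqrt (pi / s))^-1.
  rewrite /normal_peak t2; congr ((Num.sqrt _)^-1); field; lra.
have k0 : Num.sqrt (pi / s) != 0 by rewrite gt_eqF // sqrtr_gt0 divr_gt0 ?pi_gt0.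
have h x : expR (- s * x ^+ 2) = Num.sqrt (pi / s) * normal_pdf 0 t x.
  rewrite (normal_pdfE _ t0) peakE mulVKf // /normal_fun t2.
  congr expR; field; lra.
under eq_integral do rewrite h EFinM.
rewrite integralZl //=; last exact: integrable_normal_pdf.
by rewrite integral_normal_pdf mule1.
Qed.

Lemma integral_gauss2 (s : R) : 0 < s ->
  (\int[leb2]_p (expR (- s * sqn p))%:E = (pi / s)%:E)%E.
Proof.
move=> s0; have ps : 0 <= pi / s by rewrite divr_ge0 ?pi_ge0 ?ltW.
have mg : measurable_fun [set: R] (fun x : R => expR (- s * x ^+ 2)).
  apply: measurableT_comp => //; apply: measurable_funM => //; exact: measurable_funX.
rewrite fubini_tonelli1 /=; last 2 first.
- apply/measurable_EFinP; apply: measurableT_comp => //.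
  by apply: measurable_funM => //; exact: measurable_sqn.
- by move=> p; rewrite lee_fin expR_ge0.
rewrite /fubini_F /=.
transitivity (\int[lebesgue_measure]_x
  ((Num.sqrt (pi / s))%:E * (expR (- s * x ^+ 2))%:E))%E.
  apply: eq_integral => x _.
  under eq_integral => y _ do rewrite /sqn /= mulrDr expRD EFinM.
  rewrite ge0_integralZl_EFin //; first by rewrite integral_gauss1 // muleC.
  by apply/measurable_EFinP.
rewrite ge0_integralZl_EFin //.
- by rewrite integral_gauss1 // -EFinM -expr2 sqr_sqrtr.
- exact/measurable_EFinP.
Qed.

(** [x ^+ n / n!] is a single term of the exponential series, whose terms are all nonnegative. *)
Lemma expR_ge_monomial (n : nat) (x : R) : 0 <= x -> x ^+ n <= n`!%:R * expR x.
Proof.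
move=> x0; rewrite mulrC -ler_pdivrMr ?ltr0n ?fact_gt0 //.
case: n => [|n].
  by rewrite expr0 fact0 divr1 (le_trans _ (expR_ge1Dx x)) // lerDl.
by apply: le_trans (expR_ge1Dxn n x0); rewrite lerDr.
Qed.

Lemma measurable_sqn_gauss m (s : R) :
  measurable_fun setT (fun p => sqn p ^+ m * expR (- s * sqn p)).
Proof.
apply: measurable_funM.
  by apply: measurable_funX; exact: measurable_sqn.
by apply: measurableT_comp => //; apply: measurable_funM => //; exact: measurable_sqn.
Qed.

Lemma integrable_sqn_gauss m (s : R) : 0 < s ->
  (leb2 : measure _ _).-integrable setT (EFin \o (fun p => sqn p ^+ m * expR (- s * sqn p))).
Proof.
move=> s0.
(* Half of the exponent absorbs the polynomial: [c] bounds |z|^(2m) exp(- s |z|^2 / 2) by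
   [expR_ge_monomial], and the other half is still integrable. *)
pose c := (2 / s) ^+ m * m`!%:R.
apply: (@le_integrable _ _ _ leb2 _ measurableT _
          (fun p => (c * expR (- (s / 2) * sqn p))%:E)).
- by apply/measurable_EFinP; exact: measurable_sqn_gauss.
- move=> p _ /=; rewrite lee_fin !ger0_norm ?mulr_ge0 ?exprn_ge0 ?sqn_ge0 ?expR_ge0 //;
    last by rewrite divr_ge0 // ltW.
  have q0 : 0 <= s / 2 * sqn p by rewrite mulr_ge0 ?sqn_ge0 // divr_ge0 // ltW.
  have -> : - s * sqn p = s / 2 * sqn p * (-1) + - (s / 2) * sqn p by field.
  rewrite expRD mulrA ler_wpM2r ?expR_ge0 // mulrN1 expRN.
  rewrite ler_pdivrMr ?expR_gt0 //.
  have -> : sqn p ^+ m = (2 / s) ^+ m * (s / 2 * sqn p) ^+ m.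
    by rewrite -exprMn; congr (_ ^+ _); field; lra.
  rewrite /c -[leRHS]mulrA; apply: ler_wpM2l; last exact: expR_ge_monomial.
  by rewrite exprn_ge0 // divr_ge0 // ltW.
- have : (leb2 : measure _ _).-integrable setT (fun p => (expR (- (s / 2) * sqn p))%:E).
    apply/integrableP; split.
      apply/measurable_EFinP; apply: measurableT_comp => //.
      by apply: measurable_funM => //; exact: measurable_sqn.
    under eq_integral do rewrite /= ger0_norm ?expR_ge0 //.
    by rewrite integral_gauss2 ?ltry // divr_gt0.
  by move=> /(integrableZl measurableT c).
Qed.

Lemma moment_sqn m (s : R) : 0 < s ->
  Rintegral leb2 setT (fun p => sqn p ^+ m * expR (- s * sqn p))
  = pi * m`!%:R / s ^+ m.+1.
Proof.
elim: m s => [|m IH] s s0.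
  rewrite /Rintegral.
  by under eq_integral do rewrite expr0 mul1r; rewrite integral_gauss2 //= fact0 mulr1 expr1.
pose f (x : R) (p : plane) := sqn p ^+ m * expR (- x * sqn p).
(* A neighbourhood of [s] bounded away from 0: on it the derivative in the parameter is dominated by
   the integrable function with rate [s / 2]. *)
have Is : `](s / 2), (s + 1)[%classic s by rewrite /= in_itv /=; apply/andP; split; lra.
have df (x : R) (p : plane) : is_derive x 1 (f ^~ p : R -> R)
    (- (sqn p ^+ m.+1 * expR (- x * sqn p))).
  rewrite /f.
  have de : is_derive x 1 (fun y : R => expR (- y * sqn p)) (- sqn p * expR (- x * sqn p)).
    have dl : is_derive x 1 (fun y : R => - y * sqn p) (- sqn p).
      apply: is_derive_eq.
      by rewrite /GRing.scale /=; ring.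
    apply: is_derive_eq.
    by rewrite /GRing.scale /=; ring.
  apply: is_derive_eq.
  by rewrite /GRing.scale /= exprS; ring.
have d1f x p : partial1of2 f x p = - (sqn p ^+ m.+1 * expR (- x * sqn p)).
  by rewrite /partial1of2 derive1E; apply: derive_val.
have intf x : `](s / 2), (s + 1)[%classic x ->
    (leb2 : measure _ _).-integrable setT (EFin \o f x).
  by move=> /=; rewrite in_itv /= => /andP[x1 _]; apply: integrable_sqn_gauss; lra.
have G0 p : 0 <= sqn p ^+ m.+1 * expR (- (s / 2) * sqn p).
  by rewrite mulr_ge0 ?exprn_ge0 ?sqn_ge0 ?expR_ge0.
have Gub x p : `](s / 2), (s + 1)[%classic x -> setT p ->
    `|partial1of2 f x p| <= sqn p ^+ m.+1 * expR (- (s / 2) * sqn p).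
  move=> /=; rewrite in_itv /= => /andP[x1 _] _.
  rewrite d1f normrN ger0_norm ?mulr_ge0 ?exprn_ge0 ?sqn_ge0 ?expR_ge0 //.
  rewrite ler_wpM2l ?exprn_ge0 ?sqn_ge0 // ler_expR ler_wpM2r ?sqn_ge0 //; lra.
have s20 : 0 < s / 2 by rewrite divr_gt0.
have := differentiation_under_integral measurableT Is intf
  (fun x p _ _ => @ex_derive _ _ _ _ _ _ _ (df x p)) G0 (integrable_sqn_gauss m.+1 s20) Gub.
under [in RHS]eq_Rintegral => p _ do rewrite d1f -mulN1r.
rewrite RintegralZl //; last exact: integrable_sqn_gauss.
rewrite mulN1r => /(congr1 -%R); rewrite opprK => <-.
rewrite derive1E.
(* The induction hypothesis needs a positive parameter, so the two functions agree only near [s],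
   which determines the derivative. *)
rewrite (@near_eq_derive _ R^o R^o _ (fun x => pi * m`!%:R * (x ^+ m.+1)^-1)); last first.
  near=> x; apply: IH; near: x; exact: lt_nbhsr.
have sm : s ^+ m.+1 != 0 by rewrite expf_neq0 // gt_eqF.
have : is_derive s 1 (fun x : R => pi * m`!%:R * (x ^+ m.+1)^-1 : R)
   (- (pi * m.+1`!%:R / s ^+ m.+2)).
  have dX : is_derive s 1 (fun x : R => x ^+ m.+1) (m.+1%:R * s ^+ m).
    have -> : (fun x : R => x ^+ m.+1) = (id : R -> R) ^+ m.+1.
      by apply/funext => x; rewrite exprfctE.
    by apply: is_derive_eq; rewrite /GRing.scale /= mulr1.
  have dV := @is_deriveV R (fun x : R => x ^+ m.+1) s _ 1 sm dX.
  apply: is_derive_eq.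
  rewrite /GRing.scale /= factS natrM. rewrite !exprS; field.
  by rewrite expf_neq0 gt_eqF.
by move=> [_ ->]; rewrite opprK.
Unshelve. all: by end_near.
Qed.


End GaussianMoments.

(** * Square-integrable functions on the plane *)

Section ComplexFacts.
Variable R : realType.
Implicit Types z w : R[i].

Lemma cmodsqE z : cmod z ^+ 2 = complex.Re z ^+ 2 + complex.Im z ^+ 2.
Proof. by rewrite sqr_sqrtr // addr_ge0 ?sqr_ge0. Qed.

Lemma cmodsqM z w : cmod (z * w) ^+ 2 = cmod z ^+ 2 * cmod w ^+ 2.
Proof. by rewrite !cmodsqE; case: z w => [a b] [c d] /=; ring. Qed.

Lemma cmodsqN z : cmod (- z) ^+ 2 = cmod z ^+ 2.
Proof. by rewrite !cmodsqE; case: z => [a b] /=; ring. Qed.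

Lemma cmodsq_conj z : cmod z^*%C ^+ 2 = cmod z ^+ 2.
Proof. by rewrite !cmodsqE; case: z => [a b] /=; ring. Qed.

Lemma cmodsqD_le z w : cmod (z + w) ^+ 2 <= 2 * cmod z ^+ 2 + 2 * cmod w ^+ 2.
Proof.
rewrite !cmodsqE; case: z w => [a b] [c d] /=.
by have := sqr_ge0 (a - c); have := sqr_ge0 (b - d); nra.
Qed.

Lemma mul_conjE z : z * z^*%C = (cmod z ^+ 2)%:C.
Proof.
rewrite cmodsqE; case: z => [a b]; apply/eqP; rewrite eq_complex /=.
by apply/andP; split; apply/eqP; ring.
Qed.

Lemma complexReM z w : complex.Re (z * w)
  = complex.Re z * complex.Re w - complex.Im z * complex.Im w.
Proof. by case: z w => [a b] [c d]. Qed.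

Lemma complexImM z w : complex.Im (z * w)
  = complex.Re z * complex.Im w + complex.Im z * complex.Re w.
Proof. by case: z w => [a b] [c d]. Qed.

Lemma complexReD z w : complex.Re (z + w) = complex.Re z + complex.Re w.
Proof. by case: z w => [a b] [c d]. Qed.

Lemma complexImD z w : complex.Im (z + w) = complex.Im z + complex.Im w.
Proof. by case: z w => [a b] [c d]. Qed.

Lemma complexReB z w : complex.Re (z - w) = complex.Re z - complex.Re w.
Proof. by case: z w => [a b] [c d]. Qed.

Lemma complexImB z w : complex.Im (z - w) = complex.Im z - complex.Im w.
Proof. by case: z w => [a b] [c d]. Qed.

Lemma complexRI z w : complex.Re z = complex.Re w -> complex.Im z = complex.Im w -> z = w.
Proof. by case: z w => [a b] [c d] /= -> ->. Qed.

Lemma complexRe_sum I (s : seq I) P (F : I -> R[i]) :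
  complex.Re (\sum_(i <- s | P i) F i) = \sum_(i <- s | P i) complex.Re (F i).
Proof. by apply: (big_morph _ complexReD). Qed.

Lemma complexIm_sum I (s : seq I) P (F : I -> R[i]) :
  complex.Im (\sum_(i <- s | P i) F i) = \sum_(i <- s | P i) complex.Im (F i).
Proof. by apply: (big_morph _ complexImD). Qed.

Lemma complexReJ z : complex.Re z^*%C = complex.Re z. Proof. by case: z. Qed.
Lemma complexImJ z : complex.Im z^*%C = - complex.Im z. Proof. by case: z. Qed.

End ComplexFacts.

Section L2Space.
Variable R : realType.
Local Notation plane := (plane R).
Local Notation leb2 := (@leb2 R).
Local Notation mu := (leb2 : measure _ _).
Implicit Types (f g h : plane -> R[i]) (A : set plane).

Lemma L2_integrable f : L2 f -> mu.-integrable setT (EFin \o (fun p => cmod (f p) ^+ 2)).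
Proof.
move=> [mr mi fi]; apply/integrableP; split.
  apply/measurable_EFinP; under eq_fun do rewrite cmodsqE.
  by apply: measurable_funD; exact: measurable_funX.
by under eq_integral do rewrite /= ger0_norm ?sqr_ge0 //.
Qed.

Lemma L2P f : measurable_fun setT (fun p => complex.Re (f p)) ->
  measurable_fun setT (fun p => complex.Im (f p)) ->
  mu.-integrable setT (EFin \o (fun p => cmod (f p) ^+ 2)) -> L2 f.
Proof.
move=> mr mi /integrableP[_ fi]; split => //.
by under eq_integral do rewrite -[_ ^+ 2]ger0_norm ?sqr_ge0 //.
Qed.

Lemma L2_le f (G : plane -> R) : measurable_fun setT (fun p => complex.Re (f p)) ->
  measurable_fun setT (fun p => complex.Im (f p)) ->
  mu.-integrable setT (EFin \o G) -> (forall p, cmod (f p) ^+ 2 <= G p) -> L2 f.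
Proof.
move=> mr mi iG le; apply: L2P => //; apply: le_integrable iG => //.
  apply/measurable_EFinP; under eq_fun do rewrite cmodsqE.
  by apply: measurable_funD; exact: measurable_funX.
move=> p _; rewrite lee_fin /= ger0_norm ?sqr_ge0 // (le_trans (le p)) //.
exact: ler_norm.
Qed.

Lemma L2D f g : L2 f -> L2 g -> L2 (fun p => f p + g p).
Proof.
move=> Lf Lg; have [mfr mfi _] := Lf; have [mgr mgi _] := Lg.
apply: (@L2_le _ (fun p => 2 * cmod (f p) ^+ 2 + 2 * cmod (g p) ^+ 2)).
- by under eq_fun do rewrite complexReD; exact: measurable_funD.
- by under eq_fun do rewrite complexImD; exact: measurable_funD.
- have := integrableD measurableT (integrableZl measurableT 2 (L2_integrable Lf))
    (integrableZl measurableT 2 (L2_integrable Lg)).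
  by apply: eq_integrable.
- by move=> p; exact: cmodsqD_le.
Qed.

Lemma L2Z c f : L2 f -> L2 (fun p => c * f p).
Proof.
move=> Lf; have [mfr mfi _] := Lf.
apply: (@L2_le _ (fun p => cmod c ^+ 2 * cmod (f p) ^+ 2)).
- by under eq_fun do rewrite complexReM; apply: measurable_funB; exact: measurable_funM.
- by under eq_fun do rewrite complexImM; apply: measurable_funD; exact: measurable_funM.
- by have := integrableZl measurableT (cmod c ^+ 2) (L2_integrable Lf); apply: eq_integrable.
- by move=> p; rewrite cmodsqM.
Qed.

Lemma L20 : L2 (fun _ : plane => 0 : R[i]).
Proof.
split => //=; under eq_integral do rewrite cmodsqE /= expr0n addr0.
by rewrite integral0 ltry.
Qed.

Lemma L2_sum I (s : seq I) (F : I -> plane -> R[i]) :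
  (forall i, L2 (F i)) -> L2 (fun p => \sum_(i <- s) F i p).
Proof.
move=> LF; elim: s => [|i s IH].
  by under eq_fun do rewrite big_nil; exact: L20.
by under eq_fun do rewrite big_cons; exact: L2D.
Qed.

Lemma L2B f g : L2 f -> L2 g -> L2 (fun p => f p - g p).
Proof.
move=> Lf /(L2Z (-1)) Lg; have := L2D Lf Lg.
by under eq_fun do rewrite mulN1r.
Qed.

(** Both parts are bounded by |f|^2 + |g|^2, as the squares of sums and differences of the
    components are nonnegative. This integrability underlies the linearity of [inner]. *)
Lemma L2_prod f g : L2 f -> L2 g ->
  mu.-integrable setT (EFin \o (fun p => complex.Re (f p * (g p)^*%C))) /\
  mu.-integrable setT (EFin \o (fun p => complex.Im (f p * (g p)^*%C))).
Proof.
move=> Lf Lg; have [mfr mfi _] := Lf; have [mgr mgi _] := Lg.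
have := integrableD measurableT (L2_integrable Lf) (L2_integrable Lg).
move=> iG; split; apply: le_integrable iG => //.
- apply/measurable_EFinP; under eq_fun do rewrite complexReM complexReJ complexImJ.
  apply: measurable_funB; apply: measurable_funM => //.
  exact: measurable_funN.
- move=> p _ /=; rewrite lee_fin /= [leRHS]ger0_norm ?addr_ge0 ?sqr_ge0 //.
  rewrite !cmodsqE; case: (f p) (g p) => [a b] [c d] /=.
  have := sqr_ge0 (a - c); have := sqr_ge0 (b - d).
  have := sqr_ge0 (a + c); have := sqr_ge0 (b + d).
  by move=> *; rewrite ler_norml; apply/andP; split; nra.
- apply/measurable_EFinP; under eq_fun do rewrite complexImM complexReJ complexImJ.
  apply: measurable_funD; apply: measurable_funM => //.
  exact: measurable_funN.
- move=> p _ /=; rewrite lee_fin /= [leRHS]ger0_norm ?addr_ge0 ?sqr_ge0 //.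
  rewrite !cmodsqE; case: (f p) (g p) => [a b] [c d] /=.
  have := sqr_ge0 (a - d); have := sqr_ge0 (b - c).
  have := sqr_ge0 (a + d); have := sqr_ge0 (b + c).
  by move=> *; rewrite ler_norml; apply/andP; split; nra.
Qed.

Lemma innerDl A f g h : measurable A -> L2 f -> L2 g -> L2 h ->
  inner A (fun p => f p + g p) h = inner A f h + inner A g h.
Proof.
move=> mA Lf Lg Lh.
have [[fr fi] [gr gi]] := (L2_prod Lf Lh, L2_prod Lg Lh).
have sA := @integrableS _ _ _ mu _ _ _ measurableT mA (@subsetT _ A).
apply: complexRI; rewrite /inner /cint /= ?complexReD ?complexImD /=.
  rewrite -RintegralD //; try exact: sA.
  by apply: eq_Rintegral => p _; rewrite mulrDl complexReD.
rewrite -RintegralD //; try exact: sA.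
by apply: eq_Rintegral => p _; rewrite mulrDl complexImD.
Qed.

Lemma innerZl A c f g : measurable A -> L2 f -> L2 g ->
  inner A (fun p => c * f p) g = c * inner A f g.
Proof.
move=> mA Lf Lg; have [fr fi] := L2_prod Lf Lg.
have sA := @integrableS _ _ _ mu _ _ _ measurableT mA (@subsetT _ A).
apply: complexRI; rewrite /inner /cint /= ?complexReM ?complexImM /=.
  rewrite -!RintegralZl ?sA // -RintegralB //.
  - by apply: eq_Rintegral => p _; rewrite -mulrA complexReM.
  - by have := integrableZl mA (complex.Re c) (sA _ fr); apply: eq_integrable.
  - by have := integrableZl mA (complex.Im c) (sA _ fi); apply: eq_integrable.
rewrite -!RintegralZl ?sA // -RintegralD //.
- by apply: eq_Rintegral => p _; rewrite -mulrA complexImM.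
- by have := integrableZl mA (complex.Re c) (sA _ fi); apply: eq_integrable.
- by have := integrableZl mA (complex.Im c) (sA _ fr); apply: eq_integrable.
Qed.

Lemma innerC A f g : measurable A -> L2 f -> L2 g -> inner A g f = (inner A f g)^*%C.
Proof.
move=> mA Lf Lg; have [fr fi] := L2_prod Lf Lg.
have sA := @integrableS _ _ _ mu _ _ _ measurableT mA (@subsetT _ A).
apply: complexRI; rewrite ?complexReJ ?complexImJ /inner /cint /=.
  by apply: eq_Rintegral => p _; case: (f p) (g p) => [a b] [c d] /=; ring.
rewrite -mulN1r -RintegralZl ?sA //.
by apply: eq_Rintegral => p _; case: (f p) (g p) => [a b] [c d] /=; ring.
Qed.

Lemma inner_norm2 f : inner setT f f = (norm2 f)%:C.
Proof.
rewrite /inner /cint /norm2; apply: complexRI => /=.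
  by apply: eq_Rintegral => p _; rewrite mul_conjE.
under eq_Rintegral do rewrite mul_conjE /=.
by rewrite Rintegral_cst // mul0r.
Qed.

Lemma norm2_ge0 f : 0 <= norm2 f.
Proof. by apply: Rintegral_ge0 => p _; exact: sqr_ge0. Qed.

End L2Space.

(** * Inner-product algebra, Cauchy-Schwarz and Bessel inequalities *)

Section Hilbert.
Variable R : realType.
Local Notation plane := (plane R).
Local Notation leb2 := (@leb2 R).
Local Notation mu := (leb2 : measure _ _).
Implicit Types (f g h : plane -> R[i]) (A : set plane).

Lemma inner0l A g : inner A (fun _ => 0) g = 0.
Proof.
by apply: complexRI; rewrite /inner /cint /=; under eq_Rintegral do rewrite mul0r /=;
  rewrite /Rintegral integral0.
Qed.

Lemma inner_suml A I (s : seq I) (F : I -> plane -> R[i]) g : measurable A ->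
  (forall i, L2 (F i)) -> L2 g ->
  inner A (fun p => \sum_(i <- s) F i p) g = \sum_(i <- s) inner A (F i) g.
Proof.
move=> mA LF Lg; elim: s => [|i s IH].
  by under eq_fun do rewrite big_nil; rewrite big_nil inner0l.
under eq_fun do rewrite big_cons.
by rewrite innerDl ?IH ?big_cons //; exact: L2_sum.
Qed.

Lemma inner_lincombl A I (s : seq I) (a : I -> R[i]) (F : I -> plane -> R[i]) g :
  measurable A -> (forall i, L2 (F i)) -> L2 g ->
  inner A (fun p => \sum_(i <- s) a i * F i p) g = \sum_(i <- s) a i * inner A (F i) g.
Proof.
move=> mA LF Lg; rewrite (inner_suml _ (F := fun i p => a i * F i p)) //.
  by apply: eq_bigr => i _; rewrite innerZl.
by move=> i; exact: L2Z.
Qed.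

Lemma inner_lincombr A I (s : seq I) (a : I -> R[i]) (F : I -> plane -> R[i]) f :
  measurable A -> (forall i, L2 (F i)) -> L2 f ->
  inner A f (fun p => \sum_(i <- s) a i * F i p) = \sum_(i <- s) (a i)^*%C * inner A f (F i).
Proof.
move=> mA LF Lf.
have Ls : L2 (fun p => \sum_(i <- s) a i * F i p).
  by apply: (L2_sum _ (F := fun i p => a i * F i p)) => i; exact: L2Z.
rewrite (innerC mA Ls Lf) inner_lincombl // rmorph_sum /=.
by apply: eq_bigr => i _; rewrite rmorphM /=; congr (_ * _); exact/esym/innerC.
Qed.

Lemma innerDr A f g h : measurable A -> L2 f -> L2 g -> L2 h ->
  inner A h (fun p => f p + g p) = inner A h f + inner A h g.
Proof.
move=> mA Lf Lg Lh; rewrite (innerC mA (L2D Lf Lg) Lh) innerDl // rmorphD /=.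
by congr (_ + _); exact/esym/innerC.
Qed.

Lemma innerZr A c f g : measurable A -> L2 f -> L2 g ->
  inner A f (fun p => c * g p) = c^*%C * inner A f g.
Proof.
move=> mA Lf Lg; rewrite (innerC mA (L2Z c Lg) Lf) innerZl // rmorphM.
by congr (_ * _); exact/esym/innerC.
Qed.

Lemma norm2D f g : L2 f -> L2 g ->
  norm2 (fun p => f p + g p) = norm2 f + norm2 g + 2 * complex.Re (inner setT f g).
Proof.
move=> Lf Lg; have Lfg := L2D Lf Lg.
have : (norm2 (fun p => f p + g p))%:C = (norm2 f)%:C + (norm2 g)%:C
    + (inner setT f g + (inner setT f g)^*%C).
  rewrite -!inner_norm2 innerDl // !innerDr // (innerC measurableT Lf Lg). ring.
move=> /(congr1 (@complex.Re R)); rewrite !complexReD complexReJ /= => ->; ring.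
Qed.

Lemma norm2Z c f : L2 f -> norm2 (fun p => c * f p) = cmod c ^+ 2 * norm2 f.
Proof.
move=> Lf; rewrite /norm2 -RintegralZl //; last exact: L2_integrable.
by apply: eq_Rintegral => p _; rewrite cmodsqM.
Qed.

Lemma norm2N f : norm2 (fun p => - f p) = norm2 f.
Proof. by apply: eq_Rintegral => p _; rewrite cmodsqN. Qed.

(** [norm2] is a squared norm, so this takes the place of the triangle inequality in approximation
    arguments, at the cost of a factor 2. *)
Lemma norm2D_le f g : L2 f -> L2 g ->
  norm2 (fun p => f p + g p) <= 2 * norm2 f + 2 * norm2 g.
Proof.
move=> Lf Lg; rewrite /norm2.
have [If Ig] := (L2_integrable Lf, L2_integrable Lg).
have I2f : mu.-integrable setT (EFin \o (fun p => 2 * cmod (f p) ^+ 2)).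
  by have := integrableZl measurableT 2 If; apply: eq_integrable.
have I2g : mu.-integrable setT (EFin \o (fun p => 2 * cmod (g p) ^+ 2)).
  by have := integrableZl measurableT 2 Ig; apply: eq_integrable.
rewrite -!RintegralZl // -RintegralD //; apply: le_Rintegral => //.
- exact: L2_integrable (L2D Lf Lg).
- by have := integrableD measurableT I2f I2g; apply: eq_integrable.
- by move=> p _; exact: cmodsqD_le.
Qed.

Lemma cauchy_schwarz f g : L2 f -> L2 g ->
  cmod (inner setT f g) ^+ 2 <= norm2 f * norm2 g.
Proof.
move=> Lf Lg; set a := inner setT f g.
(* Expansion of the squared norm of f - t a g, a quadratic in the real parameter [t]. *)
have key (t : R) : 0 <= norm2 f - 2 * t * cmod a ^+ 2 + t ^+ 2 * cmod a ^+ 2 * norm2 g.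
  have Lh : L2 (fun p => - t%:C * a * g p) by exact: L2Z.
  have := norm2_ge0 (fun p => f p + - t%:C * a * g p).
  rewrite norm2D // norm2Z // (innerC _ Lh Lf) // complexReJ innerZl //.
  rewrite (innerC _ Lf Lg) // -/a -[_ * a * _]mulrA mul_conjE complexReM /= !cmodsqM cmodsqN.
  rewrite [cmod t%:C ^+ 2]cmodsqE /=.
  by congr (0 <= _); ring.
have n0 := norm2_ge0 g; have a0 := sqr_ge0 (cmod a).
(* If g has positive norm, the minimising parameter 1 / [norm2 g] yields the inequality. *)
have [ng|ng] := ltP 0 (norm2 g).
  have := key (norm2 g)^-1.
  rewrite -(@ler_pM2r _ (norm2 g)) // mul0r.
  set x := norm2 g in ng *; set y := cmod a ^+ 2; set w := norm2 f.
  have -> : (w - 2 * x^-1 * y + x^-1 ^+ 2 * y * x) * x = w * x - y by field; lra.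
  by lra.
have g0 : norm2 g = 0 by apply/eqP; rewrite eq_le ng n0.
move: key; rewrite g0 mulr0 => key.
rewrite leNgt; apply/negP => apos.
(* With [norm2 g = 0] the quadratic degenerates to an affine function; this parameter is chosen to
   give it the value -1. *)
have := key ((norm2 f + 1) / (2 * cmod a ^+ 2)).
have -> : 2 * ((norm2 f + 1) / (2 * cmod a ^+ 2)) * cmod a ^+ 2 = norm2 f + 1.
  by field; rewrite -sqrf_eq0 gt_eqF.
lra.
Qed.

Section Orthogonal.
Variables (I : eqType) (phi : I -> plane -> R[i]).
Hypothesis Lphi : forall i, L2 (phi i).
Hypothesis ortho : forall i j, i != j -> inner setT (phi i) (phi j) = 0.

Lemma L2_lincomb (s : seq I) (a : I -> R[i]) : L2 (fun p => \sum_(i <- s) a i * phi i p).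
Proof. by apply: (L2_sum _ (F := fun i p => a i * phi i p)) => i; exact: L2Z. Qed.

Lemma pythagoras (s : seq I) (a : I -> R[i]) : uniq s ->
  norm2 (fun p => \sum_(i <- s) a i * phi i p)
  = \sum_(i <- s) cmod (a i) ^+ 2 * norm2 (phi i).
Proof.
elim: s => [_|i s IH /= /andP[sNi us]].
  rewrite /norm2; under eq_Rintegral do rewrite big_nil cmodsqE /= expr0n addr0.
  by rewrite big_nil Rintegral_cst // mul0r.
under eq_fun do rewrite big_cons.
rewrite norm2D ?IH ?norm2Z ?big_cons //; [|exact: L2Z|exact: L2_lincomb].
rewrite innerZl //; last exact: L2_lincomb.
have -> : inner setT (phi i) (fun p => \sum_(j <- s) a j * phi j p) = 0.
  rewrite inner_lincombr // big_seq big1 // => j js.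
  by rewrite ortho ?mulr0 //; apply: contraNneq sNi => ->.
by rewrite mulr0 /= mulr0 addr0.
Qed.

Hypothesis norm_phi : forall i, norm2 (phi i) <= 1.

(** Expand the squared norm of f minus the sum of its components. The bound [norm2 (phi i) <= 1], in
    place of an equality, admits vanishing members of the family, which later stand for the indices
    outside [J]. *)
Lemma bessel (s : seq I) f : uniq s -> L2 f ->
  \sum_(i <- s) cmod (inner setT f (phi i)) ^+ 2 <= norm2 f.
Proof.
move=> us Lf; set c := fun i => inner setT f (phi i).
have Ls := L2_lincomb s c.
set S := \sum_(i <- s) cmod (c i) ^+ 2.
have eS : inner setT f (fun p => \sum_(i <- s) c i * phi i p) = S%:C.
  rewrite inner_lincombr // rmorph_sum; apply: eq_bigr => i _ /=.
  by rewrite mulrC mul_conjE.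
have := norm2_ge0 (fun p => f p + -1 * \sum_(i <- s) c i * phi i p).
rewrite norm2D //; last exact: L2Z.
rewrite norm2Z // pythagoras // (innerC _ (L2Z (-1) Ls) Lf) //.
rewrite innerZl // (innerC _ Lf Ls) // eS complexReJ complexReM /=.
have -> : cmod (-1 : R[i]) ^+ 2 = 1 by rewrite cmodsqE /=; ring.
have : \sum_(i <- s) cmod (c i) ^+ 2 * norm2 (phi i) <= S.
  by apply: ler_sum => i _; rewrite ler_piMr ?sqr_ge0.
by rewrite -/S; nra.
Qed.

End Orthogonal.
End Hilbert.

(** * Series of orthogonal functions and their kernels *)

Lemma limn_einf_le (R : realType) (v : (\bar R)^nat) (c : \bar R) :
  (forall n, (v n <= c)%E) -> (limn_einf v <= c)%E.
Proof.
move=> vc; rewrite limn_einf_lim; apply: lime_le; first exact: is_cvg_einfs.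
near=> n; apply: le_trans (vc n); apply: ereal_inf_lbound; exists n => //=.
Unshelve. all: by end_near.
Qed.

Section OrthogonalSeries.
Variable R : realType.
Local Notation plane := (plane R).
Local Notation leb2 := (@leb2 R).
Local Notation mu := (leb2 : measure _ _).
Variable phi : nat -> plane -> R[i].
Hypothesis Lphi : forall i, L2 (phi i).
Hypothesis ortho : forall i j, i != j -> inner setT (phi i) (phi j) = 0.
Hypothesis norm_phi : forall i, norm2 (phi i) <= 1.

(* Fatou's lemma along the partial sums replaces the completeness of L^2. *)
Lemma orthogonal_series (a : nat -> R[i]) (B : R) (f : plane -> R[i]) :
  (forall n, \sum_(0 <= i < n) cmod (a i) ^+ 2 <= B) ->
  (forall p, complex.Re (\sum_(0 <= i < n) a i * phi i p) @[n --> \oo] --> complex.Re (f p)) ->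
  (forall p, complex.Im (\sum_(0 <= i < n) a i * phi i p) @[n --> \oo] --> complex.Im (f p)) ->
  L2 f /\ norm2 (fun p => f p - \sum_(0 <= i < n) a i * phi i p) @[n --> \oo] --> (0 : R).
Proof.
move=> aB cRe cIm.
pose S n p := \sum_(0 <= i < n) a i * phi i p.
pose u n := \sum_(0 <= i < n) cmod (a i) ^+ 2.
have LS n : L2 (S n) by exact: L2_lincomb.
have u_nd : {homo u : n m / (n <= m)%N >-> n <= m}.
  move=> n m nm; rewrite /u (big_cat_nat _ (m := 0%N) (n := n) (p := m)) //= lerDl.
  by apply: sumr_ge0 => i _; exact: sqr_ge0.
have u_cvg : cvgn u.
  by apply: nondecreasing_is_cvgn => //; exists B => _ [n _ <-]; exact: aB.
(* By Pythagoras the partial sums are Cauchy in L^2, with rate the tail of the convergent series of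
   squared coefficients. *)
have dS n k : norm2 (fun p => S (n + k)%N p - S n p) <= limn u - u n.
  have e p : S (n + k)%N p - S n p = \sum_(n <= i < n + k) a i * phi i p.
    rewrite /S (big_cat_nat _ (m := 0%N) (n := n) (p := (n + k)%N)) ?leq_addr //=.
    by rewrite addrAC subrr add0r.
  under eq_fun do rewrite e.
  rewrite pythagoras ?iota_uniq //.
  apply: (@le_trans _ _ (u (n + k)%N - u n)); last first.
    by rewrite lerD2r; exact: nondecreasing_cvgn_le.
  rewrite /u (big_cat_nat _ (m := 0%N) (n := n) (p := (n + k)%N)) ?leq_addr //=.
  rewrite addrAC subrr add0r.
  by apply: ler_sum => i _; rewrite ler_piMr ?sqr_ge0.
have mRe : measurable_fun setT (fun p => complex.Re (f p)).
  apply: (@measurable_fun_cvg _ _ _ _ (fun n p => complex.Re (S n p))) => [n|p _]; last exact: cRe.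
  by have [] := LS n.
have mIm : measurable_fun setT (fun p => complex.Im (f p)).
  apply: (@measurable_fun_cvg _ _ _ _ (fun n p => complex.Im (S n p))) => [n|p _]; last exact: cIm.
  by have [] := LS n.
(* Fatou's lemma in [k] with [n] fixed: the integrands tend pointwise to |f - S n|^2 and their
   integrals are bounded by the tail. The integral stays extended-real because square-integrability
   of [f] is only deduced from this bound. *)
have tail n : (\int[mu]_p (cmod (f p - S n p) ^+ 2)%:E <= (limn u - u n)%:E)%E.
  have LD k := L2_integrable (L2B (LS (n + k)%N) (LS n)).
  have := @fatou _ _ _ mu setT measurableT
    (fun k p => (cmod (S (n + k)%N p - S n p) ^+ 2)%:E) _ _.
  move=> /(_ (fun k => measurable_int _ (LD k)))/(_ _)/le_trans h.
  have cv p : limn_einf (fun k => (cmod (S (n + k)%N p - S n p) ^+ 2)%:E)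
      = (cmod (f p - S n p) ^+ 2)%:E.
    apply: (cvg_limn_einf_sup _).1; apply: cvg_EFin; first exact: nearW.
    rewrite /comp /=; under eq_fun do rewrite cmodsqE complexReB complexImB.
    rewrite cmodsqE complexReB complexImB.
    have cR : complex.Re (S (n + k)%N p) @[k --> \oo] --> complex.Re (f p).
      under eq_fun do rewrite addnC.
      by have hc := cRe p; rewrite -(cvg_shiftn n) in hc; exact: hc.
    have cI : complex.Im (S (n + k)%N p) @[k --> \oo] --> complex.Im (f p).
      under eq_fun do rewrite addnC.
      by have hc := cIm p; rewrite -(cvg_shiftn n) in hc; exact: hc.
    by apply: cvgD; apply: cvgM; apply: cvgB => //; exact: cvg_cst.
  under eq_integral do rewrite -cv.
  apply: h => [k p _|]; first by rewrite lee_fin sqr_ge0.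
  apply: limn_einf_le => k.
  rewrite -[leLHS]fineK ?lee_fin //; first exact: dS.
  by have /integrable_fin_num := LD k; apply.
have LfS n : L2 (fun p => f p - S n p).
  have [mSr mSi _] := LS n.
  split.
  - by under eq_fun do rewrite complexReB; exact: measurable_funB.
  - by under eq_fun do rewrite complexImB; exact: measurable_funB.
  - by apply: le_lt_trans (tail n) _; exact: ltry.
split.
  have := L2D (LfS 0%N) (LS 0%N).
  by under eq_fun do rewrite subrK.
have le_tail n : norm2 (fun p => f p - S n p) <= limn u - u n.
  rewrite -lee_fin /norm2 /Rintegral fineK; first exact: tail.
  by have /integrable_fin_num := L2_integrable (LfS n); apply.
apply: (@squeeze_cvgr _ _ _ _ (fun=> 0) (fun n => limn u - u n)).
- by apply: nearW => n; rewrite norm2_ge0 le_tail.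
- exact: cvg_cst.
- by rewrite -[X in _ --> X](subrr (limn u)); apply: cvgB => //; exact: cvg_cst.
Qed.

End OrthogonalSeries.

Lemma cvg_cmodsq (R : realType) (z : nat -> R[i]) (l : R[i]) :
  cmod (l - z n) ^+ 2 @[n --> \oo] --> (0 : R) ->
  (complex.Re (z n) @[n --> \oo] --> complex.Re l) /\
  (complex.Im (z n) @[n --> \oo] --> complex.Im l).
Proof.
move=> z0.
have small e : 0 < e -> \forall n \near \oo, cmod (l - z n) ^+ 2 < e ^+ 2.
  move=> e0; move/cvgrPdist_lt : z0 => /(_ (e ^+ 2) (exprn_gt0 2 e0)).
  by apply: filterS => n; rewrite sub0r normrN ger0_norm ?sqr_ge0.
split; apply/cvgrPdist_lt => e e0; near=> n.
  rewrite -complexReB -(@ltr_pXn2r _ 2) ?nnegrE ?normr_ge0 ?(ltW e0) // real_normK ?num_real //.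
  apply: le_lt_trans (_ : cmod (l - z n) ^+ 2 < _); last by near: n; exact: small.
  by rewrite cmodsqE lerDl sqr_ge0.
rewrite -complexImB -(@ltr_pXn2r _ 2) ?nnegrE ?normr_ge0 ?(ltW e0) // real_normK ?num_real //.
apply: le_lt_trans (_ : cmod (l - z n) ^+ 2 < _); last by near: n; exact: small.
by rewrite cmodsqE lerDr sqr_ge0.
Unshelve. all: by end_near.
Qed.

Lemma bounded_series_cvg (R : realType) (u : nat -> R) (B : R) :
  (forall n, \sum_(0 <= i < n) `|u i| <= B) -> cvgn (fun n => \sum_(0 <= i < n) u i).
Proof.
move=> uB; apply: (@normed_cvg _ R^o); apply: nondecreasing_is_cvgn.
  by apply: nondecreasing_series => n _ _; exact: normr_ge0.
by exists B => _ [n _ <-]; exact: uB.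
Qed.

(** * Integral operators whose kernel is an orthogonal series *)

Section Reproducing.
Variable R : realType.
Local Notation plane := (plane R).
Variable phi : nat -> plane -> R[i].
Hypothesis Lphi : forall i, L2 (phi i).
Hypothesis ortho : forall i j, i != j -> inner setT (phi i) (phi j) = 0.
Hypothesis norm_phi : forall i, norm2 (phi i) <= 1.
Variable B : plane -> R.
Hypothesis phiB : forall p n, \sum_(0 <= i < n) cmod (phi i p) ^+ 2 <= B p.

Let kn n (p q : plane) := \sum_(0 <= i < n) phi i p * (phi i q)^*%C.

Definition kernel_sum (p q : plane) : R[i] :=
  limn (fun n => complex.Re (kn n p q)) +i* limn (fun n => complex.Im (kn n p q)).

(** The i-th term has real and imaginary parts at most |phi_i p|^2 + |phi_i q|^2 in absolute value,
    so both series converge absolutely. *)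
Lemma kernel_sum_cvg p q :
  (complex.Re (kn n p q) @[n --> \oo] --> complex.Re (kernel_sum p q)) /\
  (complex.Im (kn n p q) @[n --> \oo] --> complex.Im (kernel_sum p q)).
Proof.
have bound (h : R[i] -> R) : (forall z w, `|h (z * w^*%C)| <= cmod z ^+ 2 + cmod w ^+ 2) ->
    forall n, \sum_(0 <= i < n) `|h (phi i p * (phi i q)^*%C)| <= B p + B q.
  move=> hle n; apply: le_trans (lerD (phiB p n) (phiB q n)).
  by rewrite -big_split /=; apply: ler_sum => i _; exact: hle.
split; rewrite /kernel_sum /kn /=.
  under eq_fun do rewrite complexRe_sum.
  apply: (bounded_series_cvg (bound (@complex.Re R) _)) => z w.
  rewrite !cmodsqE; case: z w => [a b] [c d] /=.
  have := sqr_ge0 (a - c); have := sqr_ge0 (b - d).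
  have := sqr_ge0 (a + c); have := sqr_ge0 (b + d).
  by move=> *; rewrite ler_norml; apply/andP; split; nra.
under eq_fun do rewrite complexIm_sum.
apply: (bounded_series_cvg (bound (@complex.Im R) _)) => z w.
rewrite !cmodsqE; case: z w => [a b] [c d] /=.
have := sqr_ge0 (a - d); have := sqr_ge0 (b - c).
have := sqr_ge0 (a + d); have := sqr_ge0 (b + c).
by move=> *; rewrite ler_norml; apply/andP; split; nra.
Qed.

Definition kernel_op (F : plane -> R[i]) (p : plane) : R[i] :=
  cint setT (fun q => kernel_sum p q * F q).

(** Conjugation makes the section in [q] a series in the [phi i] themselves, with coefficients conj
    (phi_i p); their squares have partial sums bounded by [B p], so [orthogonal_series] applies. *)
Lemma kernel_section_series p :
  L2 (fun q => (kernel_sum p q)^*%C) /\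
  norm2 (fun q => (kernel_sum p q)^*%C - \sum_(0 <= i < n) (phi i p)^*%C * phi i q)
    @[n --> \oo] --> (0 : R).
Proof.
have e n q : \sum_(0 <= i < n) (phi i p)^*%C * phi i q = (kn n p q)^*%C.
  by rewrite /kn rmorph_sum; apply: eq_bigr => i _ /=; rewrite rmorphM /= conjcK.
apply: (orthogonal_series Lphi ortho norm_phi (B := B p)) => [n|q|q].
- by under eq_bigr do rewrite cmodsq_conj; exact: phiB.
- under eq_fun do rewrite e complexReJ.
  by rewrite complexReJ; have [] := kernel_sum_cvg p q.
- under eq_fun do rewrite e complexImJ.
  by rewrite complexImJ; apply: cvgN; have [] := kernel_sum_cvg p q.
Qed.

Lemma kernel_op_inner F p : L2 F ->
  kernel_op F p = inner setT F (fun q => (kernel_sum p q)^*%C).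
Proof.
move=> LF; rewrite /kernel_op /inner; congr cint.
by apply/funext => q; rewrite conjcK mulrC.
Qed.

(** The value at [p] is the inner product of [F] with the conjugated section. By Cauchy-Schwarz it
    is the limit of the inner products with the partial sums of that section. *)
Lemma kernel_op_cvg F p : L2 F ->
  cmod (kernel_op F p - \sum_(0 <= i < n) inner setT F (phi i) * phi i p) ^+ 2
    @[n --> \oo] --> (0 : R).
Proof.
move=> LF; have [Lk k0] := kernel_section_series p.
set S := fun n q => \sum_(0 <= i < n) (phi i p)^*%C * phi i q.
have LS n : L2 (S n) by exact: L2_lincomb.
have e n : kernel_op F p - \sum_(0 <= i < n) inner setT F (phi i) * phi i p
    = inner setT F (fun q => (kernel_sum p q)^*%C + -1 * S n q).
  rewrite innerDr //; last exact: L2Z.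
  rewrite kernel_op_inner // innerZr // rmorphN1 mulN1r; congr (_ - _).
  by rewrite inner_lincombr //; apply: eq_bigr => i _; rewrite conjcK mulrC.
apply: (@squeeze_cvgr _ _ _ _ (fun=> 0)
   (fun n => norm2 F * norm2 (fun q => (kernel_sum p q)^*%C - S n q))).
- apply: nearW => n; rewrite sqr_ge0 e /=.
  have -> : (fun q => (kernel_sum p q)^*%C - S n q)
      = (fun q => (kernel_sum p q)^*%C + -1 * S n q).
    by apply/funext => q; rewrite mulN1r.
  by apply: cauchy_schwarz => //; apply: L2D => //; exact: L2Z.
- exact: cvg_cst.
- by rewrite -(mulr0 (norm2 F)); apply: cvgM => //; exact: cvg_cst.
Qed.

(** A second use of [orthogonal_series], now in the variable [p]: pointwise convergence is known,
    and Bessel bounds the coefficients by [norm2 F]. *)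
Lemma kernel_op_series F : L2 F -> L2 (kernel_op F) /\
  norm2 (fun p => kernel_op F p - \sum_(0 <= i < n) inner setT F (phi i) * phi i p)
    @[n --> \oo] --> (0 : R).
Proof.
move=> LF; apply: (orthogonal_series Lphi ortho norm_phi (B := norm2 F)) => [n|p|p].
- by apply: bessel => //; exact: iota_uniq.
- by have [] := cvg_cmodsq (kernel_op_cvg p LF).
- by have [] := cvg_cmodsq (kernel_op_cvg p LF).
Qed.

(** In the expansion of the image of [phi k] only the k-th coefficient is nonzero, so the partial
    sums are constant for [n > k] and the L^2 limit is read off. *)
Lemma kernel_op_eigen k :
  norm2 (fun p => kernel_op (phi k) p - (norm2 (phi k))%:C * phi k p) = 0.
Proof.
have [_ h] := kernel_op_series (Lphi k).
apply: (cvg_unique _ _ h) => //.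
apply: cvg_near_cst; near=> n.
congr norm2; apply/funext => p; congr (_ - _).
have kn_ : (k < n)%N by near: n; exact: nbhs_infty_gt.
rewrite (bigD1_seq k) ?iota_uniq ?mem_index_iota //= inner_norm2 big1 ?addr0 // => i ik.
by rewrite ortho 1?eq_sym // mul0r.
Unshelve. all: by end_near.
Qed.

End Reproducing.

(** * Rotations *)

Section Translation.
Variable R : realType.
Local Notation lambda := (@lebesgue_measure R).

Local Notation translate a :=
  (fun x : measurableTypeR R => x + a : measurableTypeR R).

Lemma measurable_addr (a : R) : measurable_fun [set: measurableTypeR R] (translate a).
Proof. exact: measurable_funD. Qed.

(** The pushforward gives every half-open interval its length, and this characterises Lebesgue
    measure. *)
Lemma pushforward_translation (a : R) (A : set (measurableTypeR R)) : measurable A ->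
  pushforward lambda (translate a) A = lambda A.
Proof.
move=> mA.
apply/esym/lebesgue_measure_unique => //=.
  exact: measurable_addr.
move=> ? _ [[b c] /= _ <-].
rewrite /pushforward.
have -> : translate a @^-1` `]b, c] = `](b - a), (c - a)]%classic.
  by apply/seteqP; split => x /=; rewrite !in_itv /= ltrBlDr lerBrDr.
rewrite !lebesgue_measure_itv /= !lte_fin ltrD2r.
case: ifP => // _; rewrite -!EFinD; congr (_%:E); ring.
Qed.

Lemma ge0_integral_translation (a : R) (f : measurableTypeR R -> \bar R) :
  measurable_fun setT f -> (forall x, (0 <= f x)%E) ->
  (\int[lambda]_x f (x + a)%R = \int[lambda]_x f x)%E.
Proof.
move=> mf f0.
have := @ge0_integral_pushforward _ _ _ _ R _ (measurable_addr a) lambda setT f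
  measurableT mf (fun y _ => f0 y).
rewrite preimage_setT => <-.
apply: eq_measure_integral; first exact: measurable_addr.
by move=> ? A mA _; exact: pushforward_translation.
Qed.

End Translation.

Section Rotation.
Variable R : realType.
Local Notation plane := (plane R).
Local Notation leb2 := (@leb2 R).
Local Notation mu := (leb2 : measure _ _).

(** Phrased with integrals of nonnegative functions, a form that composes directly and follows from
    Tonelli for shears. *)
Definition measure_preserving (T : plane -> plane) :=
  measurable_fun setT T /\
  forall f : plane -> \bar R, measurable_fun setT f -> (forall p, (0 <= f p)%E) ->
    (\int[mu]_p f (T p) = \int[mu]_p f p)%E.

Definition xshear (a : R) (p : plane) : plane := (p.1 + a * p.2, p.2).
Definition yshear (a : R) (p : plane) : plane := (p.1, p.2 + a * p.1).

Lemma measurable_xshear a : measurable_fun setT (xshear a).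
Proof.
apply/measurable_fun_pairP; split => /=; last exact: measurable_snd.
by apply: measurable_funD => //; exact: measurable_funM.
Qed.

Lemma measurable_yshear a : measurable_fun setT (yshear a).
Proof.
apply/measurable_fun_pairP; split => /=; first exact: measurable_fst.
by apply: measurable_funD => //; exact: measurable_funM.
Qed.

(** On each horizontal line the shear is a translation, so the inner Tonelli integral is unchanged.
    Vertical lines play this role for [yshear]. *)
Lemma xshear_preserving a : measure_preserving (xshear a).
Proof.
split=> [|f mf f0]; first exact: measurable_xshear.
have mfT : measurable_fun setT (f \o xshear a).
  exact: measurableT_comp mf (measurable_xshear a).
rewrite (fubini_tonelli2 _ mf f0) (fubini_tonelli2 _ mfT); last by move=> p; exact: f0.
apply: eq_integral => y _; rewrite /fubini_G /=.
apply: (ge0_integral_translation (a * y) (f := fun x => f (x, y))) => //.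
exact: measurableT_comp.
Qed.

Lemma yshear_preserving a : measure_preserving (yshear a).
Proof.
split=> [|f mf f0]; first exact: measurable_yshear.
have mfT : measurable_fun setT (f \o yshear a).
  exact: measurableT_comp mf (measurable_yshear a).
rewrite (fubini_tonelli1 _ mf f0) (fubini_tonelli1 _ mfT); last by move=> p; exact: f0.
apply: eq_integral => x _; rewrite /fubini_F /=.
apply: (ge0_integral_translation (a * x) (f := fun y => f (x, y))) => //.
exact: measurableT_comp.
Qed.

Lemma preserving_comp T U : measure_preserving T -> measure_preserving U ->
  measure_preserving (T \o U).
Proof.
move=> [mT hT] [mU hU]; split; first exact: measurableT_comp mT mU.
move=> f mf f0; rewrite -(hT f mf f0).
have mfT := measurableT_comp mf mT; exact: (hU (f \o T) mfT (fun p => f0 (T p))).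
Qed.

Definition rotation (c s : R) (p : plane) : plane :=
  (c * p.1 - s * p.2, s * p.1 + c * p.2).

Lemma rotation_preserving (c s : R) : c ^+ 2 + s ^+ 2 = 1 -> 1 + c != 0 ->
  measure_preserving (rotation c s).
Proof.
(* [t] is the tangent of half the angle, hence the exclusion of the half-turn. The rotation is the
   x-shear by [- t], then the y-shear by [s], then the x-shear by [- t] again. *)
move=> cs c1; pose t := s / (1 + c).
have ts : t * s = 1 - c.
  have -> : t * s = s ^+ 2 / (1 + c) by rewrite /t; field.
  have -> : s ^+ 2 = (1 - c) * (1 + c) by rewrite -subr_sqr expr1n -cs addrAC subrr add0r.
  by rewrite mulfK.
have tc : t + t * c = s by rewrite /t; field.
suff -> : rotation c s = xshear (- t) \o (yshear s \o xshear (- t)).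
  apply: preserving_comp (xshear_preserving _) _.
  exact: preserving_comp (yshear_preserving _) (xshear_preserving _).
apply/funext => -[x y]; rewrite /rotation /xshear /yshear /=.
congr (_, _).
  transitivity ((1 - t * s) * x - (t + t * (1 - t * s)) * y); last by ring.
  by rewrite ts subKr tc.
transitivity (s * x + (1 - t * s) * y); last by ring.
by rewrite ts subKr.
Qed.

(** Invariance of [A] lets extension by 0 commute with [T]; positive and negative parts are then
    handled separately. *)
Lemma Rintegral_preserving T A (f : plane -> R) : measure_preserving T ->
  measurable A -> T @^-1` A = A -> measurable_fun setT f ->
  Rintegral mu A (f \o T) = Rintegral mu A f.
Proof.
move=> [mT hT] mA TA mf; rewrite Rintegral_mkcond [RHS]Rintegral_mkcond.
have -> : (f \o T) \_ A = (f \_ A) \o T.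
  apply/funext => p; rewrite /patch /=; congr (if _ then _ else _).
  have eA : A p = A (T p) by rewrite -{1}TA.
  by apply/idP/idP => /set_mem h; apply/mem_set; rewrite ?eA // -eA.
have mg : measurable_fun setT (EFin \o (f \_ A)).
  apply/measurable_EFinP; apply/(measurable_restrictT f mA).
  exact: measurable_funS mf.
rewrite /Rintegral; congr fine.
rewrite integralE [RHS]integralE; congr (_ - _)%E.
  rewrite -(hT (EFin \o (f \_ A))^\+%E).
  - by apply: eq_integral => p _; rewrite !funeposE.
  - exact: measurable_funepos.
  - by move=> p; exact: funepos_ge0.
rewrite -(hT (EFin \o (f \_ A))^\-%E).
- by apply: eq_integral => p _; rewrite !funenegE.
- exact: measurable_funeneg.
- by move=> p; exact: funeneg_ge0.
Qed.

End Rotation.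

(** * Orthogonality on rotation-invariant sets *)

Section RotationOrthogonality.
Variable R : realType.
Local Notation plane := (plane R).
Implicit Types (f g : plane -> R[i]).

Definition unitc (t : R) : R[i] := cos t +i* sin t.

Lemma unitc_conj t : unitc t * (unitc t)^*%C = 1.
Proof. by rewrite mul_conjE cmodsqE /= cos2Dsin2. Qed.

Lemma unitcX t n : unitc t ^+ n = unitc (n%:R * t).
Proof.
elim: n => [|n IH]; first by rewrite expr0 mul0r /unitc cos0 sin0.
rewrite exprS IH -natr1 mulrDl mul1r /unitc cosD sinD.
by apply: complexRI => /=; ring.
Qed.

Definition crot (t : R) : plane -> plane := rotation (cos t) (sin t).

Lemma toC_rot t p : toC (crot t p) = unitc t * toC p.
Proof. by apply: complexRI; rewrite ?complexReM ?complexImM /toC /=; ring. Qed.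

Lemma cmod_rot t p : cmod (toC (crot t p)) = cmod (toC p).
Proof.
apply/eqP; rewrite -(@eqrXn2 _ 2) ?sqrtr_ge0 //; apply/eqP.
by rewrite toC_rot cmodsqM [cmod (unitc t) ^+ 2]cmodsqE /= cos2Dsin2 mul1r.
Qed.

Lemma rot_preserving t : 0 <= t < pi -> measure_preserving (crot t).
Proof.
move=> /andP[t0 tpi]; apply: rotation_preserving; first exact: cos2Dsin2.
(* A cosine equal to -1 would force [t = pi], by injectivity of the cosine on [0, pi]. *)
apply/eqP => /eqP; rewrite addrC addr_eq0 -cospi => /eqP/cos_inj.
by rewrite !in_itv /= t0 (ltW tpi) pi_ge0 lexx => /(_ isT isT) e; move: tpi; rewrite e ltxx.
Qed.

(** The change of variables by the rotation leaves the inner product fixed and also multiplies it by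
    [v]. *)
Lemma inner_rot_eq0 (A : set plane) t (v : R[i]) f g : 0 <= t < pi ->
  measurable A -> crot t @^-1` A = A -> L2 f -> L2 g ->
  (forall p, f (crot t p) * (g (crot t p))^*%C = v * (f p * (g p)^*%C)) -> v != 1 ->
  inner A f g = 0.
Proof.
move=> t0 mA tA Lf Lg fg v1.
have [/integrableP[/measurable_EFinP mr _] /integrableP[/measurable_EFinP mi _]] := L2_prod Lf Lg.
have e : v * inner A f g = inner A f g.
  rewrite -innerZl //; apply: complexRI; rewrite /inner /cint /=.
    rewrite -[RHS](Rintegral_preserving (rot_preserving t0) mA tA mr).
    by apply: eq_Rintegral => p _ /=; rewrite fg mulrA.
  rewrite -[RHS](Rintegral_preserving (rot_preserving t0) mA tA mi).
  by apply: eq_Rintegral => p _ /=; rewrite fg mulrA.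
move/eqP: e; rewrite -subr_eq0 -[X in _ - X]mul1r -mulrBl mulf_eq0 subr_eq0 (negPf v1) /=.
by move/eqP.
Qed.

(** The angle is small enough for both j t and k t to lie in [0, pi], where the cosine is injective,
    so u^j and u^k differ in real part. The bound [t < pi] holds because distinct [j], [k] are not
    both 0. *)
Lemma unitc_separates (j k : nat) : j != k ->
  let t := pi / (j + k).+1%:R in
  0 <= t < pi /\ unitc t ^+ j * (unitc t)^*%C ^+ k != 1.
Proof.
move=> jk t.
have n0 : (0 : R) < (j + k).+1%:R by rewrite ltr0n.
have t0 : 0 < t by rewrite divr_gt0 ?pi_gt0.
have le_pi i : (i <= j + k)%N -> 0 <= i%:R * t <= pi.
  move=> ijk; rewrite mulr_ge0 ?ler0n ?(ltW t0) //=.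
  rewrite mulrCA ger_pMr ?pi_gt0 // ler_pdivrMr // mul1r ler_nat.
  exact: leq_trans ijk _.
split.
  rewrite (ltW t0) /= /t ltr_pdivrMr // ltr_pMr ?pi_gt0 // ltr1n.
  by rewrite ltnS lt0n addn_eq0; apply: contra jk => /andP[/eqP -> /eqP ->].
apply/eqP => /(congr1 (fun z => z * unitc t ^+ k)).
rewrite -mulrA -exprMn [_^*%C * _]mulrC unitc_conj expr1n mulr1 mul1r !unitcX.
move=> /(congr1 (@complex.Re R)) /= /cos_inj.
rewrite !in_itv /= !le_pi ?leq_addl ?leq_addr // => /(_ isT isT).
move/(mulIf (lt0r_neq0 t0))/eqP; rewrite eqr_nat => /eqP e.
by move: jk; rewrite e eqxx.
Qed.

Lemma measurable_disk (r : R) : 0 < r -> measurable (disk r).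
Proof.
move=> r0.
have -> : disk r = @sqn R @^-1` `]-oo, (r ^+ 2)[.
  by apply/seteqP; split => p; rewrite /disk /= in_itv /= -[sqn p](cmodsqE (toC p))
    ltr_pXn2r // ?nnegrE ?sqrtr_ge0 ?ltW.
by rewrite -[X in measurable X]setTI; exact: measurable_sqn.
Qed.

Lemma rot_disk t (r : R) : crot t @^-1` disk r = disk r.
Proof. by apply/seteqP; split => p; rewrite /disk /= cmod_rot. Qed.

End RotationOrthogonality.

(** * Hermite functions *)

Section HermiteFunctions.
Variable R : realType.
Local Notation plane := (plane R).
Local Notation leb2 := (@leb2 R).
Local Notation mu := (leb2 : measure _ _).
Local Notation gmono n := (fun p : plane => (pi * sqn p) ^+ n * expR (- pi * sqn p)).
Variable r : nat.

Definition hermite_fun (j : nat) (p : plane) : R[i] :=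
  (expR (- (pi / 2) * cmod (toC p) ^+ 2))%:C * hermiteC j r (toC p).

Lemma ktermE j p q :
  kterm r j (toC p) (toC q) = hermite_fun j p * (hermite_fun j q)^*%C.
Proof.
have conjM (x : R) (z : R[i]) : (x%:C * z)^*%C = x%:C * z^*%C.
  by case: z => [a b]; apply: complexRI => /=; ring.
by rewrite /kterm /hermite_fun conjM mulrDr expRD rmorphM /=; ring.
Qed.

Lemma sqn_cmod (p : plane) : cmod (toC p) ^+ 2 = sqn p.
Proof. exact: cmodsqE. Qed.

Lemma cmodsqX (z : R[i]) n : cmod (z ^+ n) ^+ 2 = (cmod z ^+ 2) ^+ n.
Proof.
elim: n => [|n IH]; first by rewrite !expr0 cmodsqE /=; ring.
by rewrite [z ^+ _]exprS cmodsqM IH [RHS]exprS.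
Qed.

Lemma cmodsq_real (x : R) : cmod x%:C ^+ 2 = x ^+ 2.
Proof. by rewrite cmodsqE /=; ring. Qed.

(** [m j] is the degree of the Laguerre factor and [M j - m j] its parameter, in both cases of
    [hermiteC]. *)
Let m j := minn j r.
Let M j := maxn j r.

Lemma hermite_fun_sq j p :
  cmod (hermite_fun j p) ^+ 2 = (m j)`!%:R / (M j)`!%:R * (pi * sqn p) ^+ (M j - m j)
    * laguerre (m j) (M j - m j) (pi * sqn p) ^+ 2 * expR (- pi * sqn p).
Proof.
have fact_nneg a b : 0 <= a`!%:R / b`!%:R :> R by rewrite divr_ge0 ?ler0n.
have e2 : expR (- (pi / 2) * sqn p) ^+ 2 = expR (- pi * sqn p).
  by rewrite -expRM_natl; congr expR; field.
rewrite /hermite_fun cmodsqM cmodsq_real sqn_cmod e2 /hermiteC /m /M.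
case: ltnP => rj.
  rewrite cmodsqM cmodsq_real cmodsqX sqn_cmod !exprMn sqr_sqrtr //.
  by rewrite -exprM mulnC exprM sqr_sqrtr ?pi_ge0 //; ring.
rewrite cmodsqM cmodsq_real cmodsqX cmodsq_conj sqn_cmod !exprMn sqr_sqrtr //.
rewrite [(-1) ^+ _ ^+ 2]exprAC sqrrN !expr1n.
by rewrite [Num.sqrt pi ^+ _ ^+ 2]exprAC sqr_sqrtr ?pi_ge0 //; ring.
Qed.

Lemma hermite_fun_rot t j p :
  hermite_fun j (crot t p) = unitc t ^+ j * (unitc t)^*%C ^+ r * hermite_fun j p.
Proof.
rewrite /hermite_fun cmod_rot [RHS]mulrCA; congr (_ * _).
set u := unitc t; have u1 : u * u^*%C = 1 := unitc_conj t.
rewrite /hermiteC cmod_rot toC_rot -/u; case: ltnP => rj.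
  have -> : u ^+ j * u^*%C ^+ r = u ^+ (j - r).
    by rewrite -{1}(subnK (ltnW rj)) exprD -mulrA -exprMn u1 expr1n mulr1.
  by rewrite exprMn; ring.
have -> : u ^+ j * u^*%C ^+ r = u^*%C ^+ (r - j).
  by rewrite -{1}(subnK rj) addnC exprD mulrA -exprMn u1 expr1n mul1r.
have -> : (u * toC p)^*%C = u^*%C * (toC p)^*%C by rewrite rmorphM.
by rewrite exprMn; ring.
Qed.

(** The factors with exponent [r] cancel because |u| = 1, leaving a character that depends on [j]
    and [k] alone. *)
Lemma hermite_fun_prod_rot t j k p :
  hermite_fun j (crot t p) * (hermite_fun k (crot t p))^*%C
  = unitc t ^+ j * (unitc t)^*%C ^+ k * (hermite_fun j p * (hermite_fun k p)^*%C).
Proof.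
have u1 : (unitc t)^*%C ^+ r * unitc t ^+ r = 1 :> R[i].
  by rewrite -exprMn mulrC unitc_conj expr1n.
rewrite !hermite_fun_rot; set u := unitc t in u1 *; set v := u^*%C in u1 *.
have -> : (u ^+ k * v ^+ r * hermite_fun k p)^*%C = v ^+ k * u ^+ r * (hermite_fun k p)^*%C.
  by rewrite !rmorphM !rmorphXn; congr (_ * _ ^+ _ * _); exact: conjcK.
transitivity (u ^+ j * v ^+ k * (hermite_fun j p * (hermite_fun k p)^*%C) * (v ^+ r * u ^+ r)).
  ring.
by rewrite u1 mulr1.
Qed.

Definition cmeasurable (f : plane -> R[i]) :=
  measurable_fun setT (fun p => complex.Re (f p)) /\
  measurable_fun setT (fun p => complex.Im (f p)).

Lemma cmeasurableM f g : cmeasurable f -> cmeasurable g -> cmeasurable (fun p => f p * g p).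
Proof.
move=> [fr fi] [gr gi]; split.
  by under eq_fun do rewrite complexReM; apply: measurable_funB; exact: measurable_funM.
by under eq_fun do rewrite complexImM; apply: measurable_funD; exact: measurable_funM.
Qed.

Lemma cmeasurableX f n : cmeasurable f -> cmeasurable (fun p => f p ^+ n).
Proof.
move=> mf; elim: n => [|n IH]; first by split; exact: measurable_cst.
by under eq_fun do rewrite exprS; exact: cmeasurableM.
Qed.

Lemma cmeasurable_real (f : plane -> R) :
  measurable_fun setT f -> cmeasurable (fun p => (f p)%:C).
Proof. by move=> mf; split => //; exact: measurable_cst. Qed.

Lemma cmeasurable_conj f : cmeasurable f -> cmeasurable (fun p => (f p)^*%C).
Proof.
move=> [fr fi]; split; first by under eq_fun do rewrite complexReJ.
by under eq_fun do rewrite complexImJ; exact: measurable_funN.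
Qed.

Lemma cmeasurable_toC : cmeasurable (@toC R).
Proof. by split; [exact: measurable_fst|exact: measurable_snd]. Qed.

Lemma measurable_laguerre i a :
  measurable_fun setT (fun p : plane => laguerre i a (pi * cmod (toC p) ^+ 2)).
Proof.
rewrite /laguerre; apply: measurable_sum => k.
apply: measurable_funM => //; apply: measurable_funM => //; apply: measurable_funX.
apply: measurable_funM => //; under eq_fun do rewrite sqn_cmod.
exact: measurable_sqn.
Qed.

Lemma cmeasurable_hermite_fun j : cmeasurable (hermite_fun j).
Proof.
apply: cmeasurableM.
  apply: cmeasurable_real; apply: measurableT_comp => //; apply: measurable_funM => //.
  by under eq_fun do rewrite sqn_cmod; exact: measurable_sqn.
rewrite /hermiteC; case: ltnP => rj; apply: cmeasurableM.
- apply: cmeasurable_real; apply: measurable_funM => //; exact: measurable_laguerre.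
- exact: cmeasurableX cmeasurable_toC.
- apply: cmeasurable_real; apply: measurable_funM => //; exact: measurable_laguerre.
- exact/cmeasurableX/cmeasurable_conj/cmeasurable_toC.
Qed.

(** At rate [pi] the powers of pi in the moment formula cancel, so [gmono n] integrates to exactly
    [n!]. *)
Lemma integral_gauss_sum I (s : seq I) (a : I -> R) (n : I -> nat) :
  mu.-integrable setT (EFin \o (fun p => \sum_(i <- s) a i * gmono (n i) p)) /\
  Rintegral mu setT (fun p => \sum_(i <- s) a i * gmono (n i) p)
  = \sum_(i <- s) a i * (n i)`!%:R.
Proof.
have pi0 := pi_gt0 R.
have cancel (c x y : R) k : c != 0 -> x * c ^+ k * (c * y / c ^+ k.+1) = x * y.
  by move=> c0; rewrite exprS; field; rewrite c0 expf_neq0.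
have one i : mu.-integrable setT (EFin \o (fun p => a i * gmono (n i) p)) /\
  Rintegral mu setT (fun p => a i * gmono (n i) p) = a i * (n i)`!%:R.
  have e p : a i * ((pi * sqn p) ^+ n i * expR (- pi * sqn p))
      = a i * pi ^+ n i * (sqn p ^+ n i * expR (- pi * sqn p)) by rewrite exprMn; ring.
  have ig := integrable_sqn_gauss (n i) pi0.
  split.
    have := integrableZl measurableT (a i * pi ^+ n i) ig.
    by apply: eq_integrable => // p _ /=; rewrite e.
  under eq_Rintegral do rewrite e.
  rewrite RintegralZl // moment_sqn //; exact: cancel (lt0r_neq0 pi0).
elim: s => [|i s [IH1 IH2]].
  split.
    have := @integrable0 _ _ _ mu setT.
    by apply: eq_integrable => // p _ /=; rewrite big_nil.
  under eq_Rintegral do rewrite big_nil.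
  by rewrite big_nil Rintegral_cst // mul0r.
have [int_i val_i] := one i.
split.
  have := integrableD measurableT int_i IH1.
  by apply: eq_integrable => // p _ /=; rewrite big_cons.
under eq_Rintegral do rewrite big_cons.
by rewrite RintegralD // IH2 val_i big_cons.
Qed.

(** Squaring the Laguerre factor gives a double sum of Gaussian monomials, integrated to factorials;
    [laguerre_gram] evaluates it to M! / m!, which the normalising constant [K] cancels. *)
Lemma hermite_fun_norm j : mu.-integrable setT (EFin \o (fun p => cmod (hermite_fun j p) ^+ 2))
  /\ norm2 (hermite_fun j) = 1.
Proof.
set a := (M j - m j)%N.
have mM : (m j + a = M j)%N by rewrite /a subnKC // /m /M; lia.
pose w (i : nat) : R := (-1) ^+ i * 'C(m j + a, m j - i)%:R / i`!%:R.
pose K : R := (m j)`!%:R / (M j)`!%:R.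
have e p : cmod (hermite_fun j p) ^+ 2
    = \sum_(u <- enum {: 'I_(m j).+1 * 'I_(m j).+1})
        (K * (w u.1 * w u.2)) * gmono (a + u.1 + u.2)%N p.
  rewrite hermite_fun_sq -/a -/K big_enum /=.
  rewrite -(pair_bigA _ (fun i k : 'I_(m j).+1 =>
    (K * (w i * w k)) * gmono (a + i + k)%N p)) /=.
  rewrite expr2 /laguerre big_distrlr /= big_distrr /= big_distrl /=.
  apply: eq_bigr => i _; rewrite big_distrr /= big_distrl /=.
  apply: eq_bigr => k _; rewrite /w !exprD; ring.
have [g1 g2] := integral_gauss_sum (enum {: 'I_(m j).+1 * 'I_(m j).+1})
  (fun u => K * (w u.1 * w u.2)) (fun u => a + u.1 + u.2)%N.
split; first by move: g1; apply: eq_integrable => // p _ /=; rewrite e.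
rewrite /norm2; under eq_Rintegral do rewrite e.
rewrite g2 big_enum /=.
rewrite -(pair_bigA _ (fun i k : 'I_(m j).+1 => (K * (w i * w k)) * ((a + i + k)`!)%:R)) /=.
transitivity (K * \sum_(i < (m j).+1) \sum_(k < (m j).+1) w i * w k * ((a + i + k)`!)%:R).
  rewrite big_distrr; apply: eq_bigr => i _; rewrite big_distrr; apply: eq_bigr => k _ /=.
  by rewrite !mulrA.
rewrite laguerre_gram mM /K; field.
by rewrite !pnatr_eq0 -!lt0n !fact_gt0.
Qed.

Lemma norm2_hermite_fun j : norm2 (hermite_fun j) = 1.
Proof. by have [] := hermite_fun_norm j. Qed.

Lemma L2_hermite_fun j : L2 (hermite_fun j).
Proof.
have [mr mi] := cmeasurable_hermite_fun j.
by apply: L2P => //; have [] := hermite_fun_norm j.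
Qed.

Lemma hermite_fun_ortho (A : set plane) j k : measurable A ->
  (forall t, crot t @^-1` A = A) -> j != k ->
  inner A (hermite_fun j) (hermite_fun k) = 0.
Proof.
move=> mA rA jk; have [t0 sep] := unitc_separates R jk.
apply: (inner_rot_eq0 t0 mA (rA _) (L2_hermite_fun j) (L2_hermite_fun k) _ sep) => p.
exact: hermite_fun_prod_rot.
Qed.

(** Each of the i + 1 terms is at most 2^(i + a) e^x: a binomial coefficient is one term of (1 +
    1)^(i + a), and x^k / k! is at most e^x. *)
Lemma laguerre_le i a (x : R) : 0 <= x ->
  `|laguerre i a x| <= i.+1%:R * 2 ^+ (i + a) * expR x.
Proof.
move=> x0; rewrite /laguerre (le_trans (ler_norm_sum _ _ _)) //.
rewrite -mulrA mulr_natl -[in leRHS](card_ord i.+1) -sumr_const; apply: ler_sum => k _.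
rewrite !normrM normfV normrX normrN1 expr1n mul1r !normr_nat (ger0_norm (exprn_ge0 _ x0)).
rewrite -mulrA ler_pM ?divr_ge0 ?exprn_ge0 ?ler0n //.
  rewrite -natrX ler_nat -[X in (_ <= X ^ _)%N]/(1 + 1)%N expnDn.
  have lt : (i - k < (i + a).+1)%N by rewrite ltnS (leq_trans (leq_subr _ _)) ?leq_addr.
  by rewrite (bigD1 (Ordinal lt)) //= !exp1n !muln1 leq_addr.
by rewrite ler_pdivrMr ?ltr0n ?fact_gt0 // mulrC; exact: expR_ge_monomial.
Qed.

(** The point is a bound of the form constant times y^j / j!, summable over [j]. In [y] the 4 comes
    from the squared 2^M of [laguerre_le] and 1 + x from the power of x; since y >= 1, the exponent
    M may be raised to r + j. *)
Lemma hermite_fun_le j p (x y : R) : x = pi * sqn p -> y = 4 * (1 + x) ->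
  cmod (hermite_fun j p) ^+ 2
  <= r`!%:R * r.+1%:R ^+ 2 * expR x ^+ 2 * y ^+ r * (y ^+ j / j`!%:R).
Proof.
move=> ex ey; have x0 : 0 <= x by rewrite ex mulr_ge0 ?pi_ge0 ?sqn_ge0.
have mM : (m j + (M j - m j) = M j)%N by rewrite subnKC // /m /M; lia.
have mr : (m j <= r)%N by rewrite /m; lia.
have Mjr : (M j <= r + j)%N by rewrite /M; lia.
have f0 n : 0 < n`!%:R :> R by rewrite ltr0n fact_gt0.
rewrite hermite_fun_sq -ex.
have l2 : laguerre (m j) (M j - m j) x ^+ 2 <= (r.+1%:R * 2 ^+ M j * expR x) ^+ 2.
  rewrite -real_normK ?num_real // lerXn2r ?nnegrE ?normr_ge0 ?mulr_ge0 ?exprn_ge0 ?expR_ge0 //.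
  apply: le_trans (laguerre_le _ _ x0) _; rewrite mM.
  by rewrite !ler_wpM2r ?expR_ge0 ?exprn_ge0 // ler_nat.
have xa : x ^+ (M j - m j) <= (1 + x) ^+ M j.
  apply: (@le_trans _ _ ((1 + x) ^+ (M j - m j))).
    by rewrite lerXn2r ?nnegrE ?addr_ge0 // lerDr.
  by apply: ler_weXn2l; [rewrite lerDl|exact: leq_subr].
(* An equality when [r < j]; otherwise it says that the square of j! is at most the square of r!. *)
have ff : (m j)`!%:R / (M j)`!%:R <= r`!%:R / j`!%:R :> R.
  rewrite ler_pdivrMr // mulrAC ler_pdivlMr // -!natrM ler_nat /m /M.
  case: (leqP j r) => jr; last by rewrite mulnC.
  by rewrite leq_mul // leq_fact.
have e1 : expR (- pi * sqn p) <= 1 by rewrite expR_le1 mulNr -ex oppr_le0.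
have yM : 4 ^+ M j * (1 + x) ^+ M j <= y ^+ r * y ^+ j.
  rewrite -exprMn -exprD -ey; apply: ler_weXn2l => //.
  by rewrite ey; lra.
have ge0_1 : 0 <= (m j)`!%:R / (M j)`!%:R * x ^+ (M j - m j) :> R.
  by rewrite mulr_ge0 ?divr_ge0 ?exprn_ge0 // ltW.
apply: (@le_trans _ _ (r`!%:R / j`!%:R * (1 + x) ^+ M j * (r.+1%:R * 2 ^+ M j * expR x) ^+ 2)).
  rewrite -[leRHS]mulr1 ler_pM ?expR_ge0 ?(mulr_ge0 _ (sqr_ge0 _)) //.
  by rewrite ler_pM ?sqr_ge0 // ler_pM ?divr_ge0 ?exprn_ge0 // ltW.
have -> : r`!%:R / j`!%:R * (1 + x) ^+ M j * (r.+1%:R * 2 ^+ M j * expR x) ^+ 2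
  = r`!%:R / j`!%:R * r.+1%:R ^+ 2 * expR x ^+ 2 * (4 ^+ M j * (1 + x) ^+ M j).
  have -> : (4 : R) ^+ M j = (2 ^+ M j) ^+ 2 by rewrite -exprM mulnC exprM; congr (_ ^+ _); ring.
  by field; rewrite gt_eqF.
have -> : r`!%:R * r.+1%:R ^+ 2 * expR x ^+ 2 * y ^+ r * (y ^+ j / j`!%:R)
  = r`!%:R / j`!%:R * r.+1%:R ^+ 2 * expR x ^+ 2 * (y ^+ r * y ^+ j).
  by field; rewrite gt_eqF.
by rewrite ler_wpM2l // !mulr_ge0 ?invr_ge0 ?exprn_ge0 ?expR_ge0 // ltW.
Qed.

Lemma exp_series_le (y : R) n : 0 <= y -> \sum_(0 <= j < n) y ^+ j / j`!%:R <= expR y.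
Proof.
move=> y0; apply: (@nondecreasing_cvgn_le _ (series (exp_coeff y))).
  by apply: nondecreasing_series => k _ _; exact: exp_coeff_ge0.
exact: is_cvg_series_exp_coeff.
Qed.

Lemma hermite_fun_sum_le p : exists B, forall n,
  \sum_(0 <= j < n) cmod (hermite_fun j p) ^+ 2 <= B.
Proof.
pose x := pi * sqn p; pose y := 4 * (1 + x).
have x0 : 0 <= x by rewrite mulr_ge0 ?pi_ge0 ?sqn_ge0.
have y0 : 0 <= y by rewrite mulr_ge0 // addr_ge0.
exists (r`!%:R * r.+1%:R ^+ 2 * expR x ^+ 2 * y ^+ r * expR y) => n.
apply: (@le_trans _ _ (\sum_(0 <= j < n)
    r`!%:R * r.+1%:R ^+ 2 * expR x ^+ 2 * y ^+ r * (y ^+ j / j`!%:R))).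
  by apply: ler_sum => j _; exact: hermite_fun_le.
rewrite -big_distrr /= ler_wpM2l ?exp_series_le //.
by rewrite !mulr_ge0 ?exprn_ge0 ?expR_ge0.
Qed.

End HermiteFunctions.

(** * The kernel of the process as an orthogonal series *)

Section HermiteKernel.
Variable R : realType.
Local Notation plane := (plane R).
Variables (r : nat) (J : set nat).

(* Extension by 0 lets sums over [J] run over all natural numbers. *)
Definition hermite_on (j : nat) (p : plane) : R[i] :=
  if j \in J then hermite_fun r j p else 0.

Lemma hermite_on_in j : j \in J -> hermite_on j = hermite_fun r j.
Proof. by move=> jJ; apply/funext => p; rewrite /hermite_on jJ. Qed.

Lemma hermite_on_notin j : j \notin J -> hermite_on j = fun=> 0.
Proof. by move=> /negPf jJ; apply/funext => p; rewrite /hermite_on jJ. Qed.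

Lemma L2_hermite_on j : L2 (hermite_on j).
Proof.
have [jJ|jJ] := boolP (j \in J).
  by rewrite hermite_on_in //; exact: L2_hermite_fun.
by rewrite hermite_on_notin //; exact: L20.
Qed.

Lemma hermite_on_ortho j k : j != k -> inner setT (hermite_on j) (hermite_on k) = 0.
Proof.
move=> jk; have [jJ|jJ] := boolP (j \in J); last first.
  by rewrite (hermite_on_notin jJ) inner0l.
have [kJ|kJ] := boolP (k \in J); last first.
  rewrite (innerC _ (L2_hermite_on k) (L2_hermite_on j)) //.
  by rewrite (hermite_on_notin kJ) inner0l; exact: rmorph0.
by rewrite !hermite_on_in // hermite_fun_ortho // => t; rewrite preimage_setT.
Qed.

Lemma hermite_on_norm j : norm2 (hermite_on j) <= 1.
Proof.
have [jJ|jJ] := boolP (j \in J).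
  by rewrite hermite_on_in // norm2_hermite_fun.
rewrite hermite_on_notin // /norm2; under eq_Rintegral do rewrite cmodsqE /= expr0n addr0.
by rewrite Rintegral_cst // mul0r ler01.
Qed.

Lemma hermite_on_sum_le : {B : plane -> R | forall p n,
  \sum_(0 <= j < n) cmod (hermite_on j p) ^+ 2 <= B p}.
Proof.
have h p : {B | forall n, \sum_(0 <= j < n) cmod (hermite_on j p) ^+ 2 <= B}.
  (* Choice turns the pointwise existence of a bound into a function of [p]. *)
  apply: cid; have [B hB] := hermite_fun_sum_le r p.
  exists B => n; apply: le_trans (hB n); apply: ler_sum => j _.
  rewrite /hermite_on; case: ifP => // _.
  by rewrite [leLHS]cmodsqE /= expr0n addr0 sqr_ge0.
by exists (fun p => sval (h p)) => p n; exact: (svalP (h p)).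
Qed.

Lemma kernelKE p q : kernelK J r (toC p) (toC q) = kernel_sum hermite_on p q.
Proof.
have e n : kpart J r n (toC p) (toC q)
    = \sum_(0 <= i < n) hermite_on i p * (hermite_on i q)^*%C.
  rewrite /kpart big_mkord big_mkcond; apply: eq_bigr => i _.
  rewrite /hermite_on ktermE; case: ifP => // _.
  by rewrite mul0r.
by rewrite /kernelK /kernel_sum; congr (_ +i* _); congr (lim (_ @ \oo));
  apply/funext => n; rewrite e.
Qed.

Lemma restrop_full F : restrop (kernelK J r) setT F = kernel_op hermite_on F.
Proof.
have ind p : cind setT p = 1 :> R[i] by rewrite /cind indicE in_setT.
apply/funext => p; rewrite /restrop ind mul1r /intop /kernel_op; congr cint.
by apply/funext => q; rewrite ind mul1r kernelKE.
Qed.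

(** Observability asks for finite combinations indexed by the basis, here the subtype of [J]; the
    vanishing terms outside [J] are dropped. *)
Lemma hermite_on_lincomb (c : nat -> R[i]) n :
  exists s : seq ({j | j \in J} * R[i]), forall p,
    \sum_(0 <= j < n) c j * hermite_on j p
    = \sum_(x <- s) x.2 * hermite_fun r (val x.1) p.
Proof.
elim: n => [|n [s IH]]; first by exists [::] => p; rewrite big_geq ?big_nil.
have [nJ|nJ] := boolP (n \in J); last first.
  by exists s => p; rewrite big_nat_recr //= IH (hermite_on_notin nJ) mulr0 addr0.
exists ((exist _ n nJ, c n) :: s) => p.
by rewrite big_nat_recr //= IH big_cons (hermite_on_in nJ) addrC.
Qed.

End HermiteKernel.

Theorem theorem1p5 (R : realType) (r : nat) (J : set nat)
  (hJ : (exists N : nat, (0 < N)%N /\ J = [set j | (j < N)%N]) \/ J = setT) :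
  simultaneously_observable (kernelK J r) [set Rr : R | 0 < Rr] (@disk R).
Proof.
(* The disks exhaust the plane, so the restriction operator is the full integral operator. *)
have UT : \bigcup_(i in [set Rr : R | 0 < Rr]) disk i = setT.
  apply/seteqP; split => // p _; exists (cmod (toC p) + 1) => /=.
    by rewrite ltr_wpDl ?sqrtr_ge0.
  by rewrite /disk /= ltrDl.
have [B hB] := hermite_on_sum_le R r J.
pose psi := @hermite_on R r J.
have Lpsi := @L2_hermite_on R r J.
have Opsi := @hermite_on_ortho R r J.
have Npsi := @hermite_on_norm R r J.
have eigen (x : {j | j \in J}) : norm2 (fun p => kernel_op psi (hermite_fun r (val x)) p
    - hermite_fun r (val x) p) = 0.
  have := kernel_op_eigen Lpsi Opsi Npsi hB (val x).
  rewrite hermite_on_in ?(valP x) // norm2_hermite_fun.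
  by under eq_fun do rewrite mul1r.
rewrite /simultaneously_observable UT.
have -> : restrop (kernelK J r) setT = kernel_op psi.
  by apply/funext => F; exact: restrop_full.
exists {j | j \in J}, (fun x => hermite_fun r (val x)); split; [|split; [|split]].
- move=> x; split.
  + exact: L2_hermite_fun.
  + split; first exact: L2_hermite_fun.
    (* Having eigenvalue 1, the function approximates itself from the range with error 0. *)
    move=> e e0; exists (hermite_fun r (val x)); split; first exact: L2_hermite_fun.
    by rewrite eigen.
  + by rewrite norm2_hermite_fun.
  + by exists 1; under eq_fun do rewrite mul1r; exact: eigen.
- move=> x y xy; apply: hermite_fun_ortho => [//|t|]; first by rewrite preimage_setT.
  by apply/eqP => /val_inj.
- move=> g [Lg gT] e e0.
  (* [g] is approximated by an image [T F], and [T F] by a partial sum; [norm2D_le] doubles both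
     errors, hence the quarter. *)
  have e4 : 0 < e / 4 by rewrite divr_gt0.
  have [F [LF TFg]] := gT _ e4.
  have [LTF S0] := kernel_op_series Lpsi Opsi Npsi hB LF.
  have [n Sn] : exists n, norm2 (fun p => kernel_op psi F p
      - \sum_(0 <= i < n) inner setT F (psi i) * psi i p) < e / 4.
    move/cvgrPdist_lt : S0 => /(_ _ e4)[n _ /(_ n (leqnn n))] /=.
    by rewrite sub0r normrN ger0_norm ?norm2_ge0 // => h; exists n.
  have [s hs] := hermite_on_lincomb r J (fun i => inner setT F (psi i)) n.
  exists s.
  have LS := L2_lincomb Lpsi (index_iota 0 n) (fun i => inner setT F (psi i)).
  have -> : (fun p => g p - \sum_(x <- s) x.2 * hermite_fun r (val x.1) p)
     = (fun p => - (kernel_op psi F p - g p)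
          + (kernel_op psi F p - \sum_(0 <= i < n) inner setT F (psi i) * psi i p)).
    by apply/funext => p; rewrite -hs; ring.
  apply: le_lt_trans (norm2D_le _ _) _.
  + have := L2Z (-1) (L2B LTF Lg).
    by under eq_fun do rewrite mulN1r.
  + exact: L2B.
  + by rewrite norm2N; lra.
(* Disks are rotation-invariant, so the argument used on the whole plane applies to each of them. *)
- move=> i i0 x y xy; apply: hermite_fun_ortho; first exact: measurable_disk.
    by move=> t; exact: rot_disk.
  by apply/eqP => /val_inj.
Qed.
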